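(* Let $C_t$, $t\in[0,1]$, be a continuous expansive motion of a polygonal chain whose bars in $C_0$ have pairwise disjoint relative interiors (bars meet only at shared hinge vertices). Suppose each bar carries a slender (not necessarily symmetric) adornment with that bar as base, and the adornments in $C_0$ pairwise do not overlap. Then for every $t\in[0,1]$ the adornments, carried along rigidly with their bars, pairwise do not overlap in $C_t$.
   Context: An adornment is a compact simply connected region $S\subset\mathbb{R}^2$ together with a segment $[x,y]$, $x\ne y$, with endpoints on the boundary of $S$ and $[x,y]\subseteq S$ (the base); its boundary consists of two arcs from $x$ to $y$ (the sides). It is slender if, for a point $p$ moving along either side from $x$ to $y$, $\|p-x\|$ is nondecreasing and $\|p-y\|$ is nonincreasing. A polygonal chain consists of vertices and bars joining consecutive vertices (open or closed); a configuration assigns vertex positions preserving bar lengths. An adornment attached to a bar moves with it by the orientation-preserving rigid motion taking the bar to its new position; points of the chain in different configurations correspond via these rigid motions. Configuration $Y$ is an expansion of $X$ if for any two points $p,q$ of the chain in $X$, the corresponding points $p',q'$ in $Y$ satisfy $\|p'-q'\|\ge\|p-q\|$. A continuous expansive motion is a continuous family of configurations $C_t$, $t\in[0,1]$, such that $C_{t'}$ is an expansion of $C_t$ whenever $t\le t'$. Two adornments overlap if some point of one lies in the interior of the other. *)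

(* Defs.v *)
(* the plane is R * R (product topology = Euclidean
   topology) for an arbitrary R : realType; Euclidean distance defined below. *)
From HB Require Import structures.
From mathcomp Require Import all_boot all_order all_algebra.
From mathcomp Require Import all_classical all_reals all_analysis.
Set Implicit Arguments. Unset Strict Implicit. Unset Printing Implicit Defensive.
Import Order.TTheory GRing.Theory Num.Theory numFieldNormedType.Exports.
Local Open Scope classical_set_scope.
Local Open Scope ring_scope.

Section Plane.
Variable R : realType.

Local Notation point := (R * R)%type.

Definition I01 : set R := [set s | 0 <= s <= 1].

Definition dist (p q : point) : R :=
  Num.sqrt ((p.1 - q.1) ^+ 2 + (p.2 - q.2) ^+ 2).

Definition lerp (a b : point) (l : R) : point :=
  ((1 - l) * a.1 + l * b.1, (1 - l) * a.2 + l * b.2).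

Definition segment (a b : point) : set point := [set lerp a b l | l in I01].

Definition open_segment (a b : point) : set point :=
  [set lerp a b l | l in [set l : R | 0 < l < 1]].

Definition frontier (S : set point) : set point := closure S `\` interior S.

Definition arc (g : R -> point) (x y : point) : Prop :=
  {within I01, continuous g} /\
  (forall s u, I01 s -> I01 u -> g s = g u -> s = u) /\
  g 0 = x /\ g 1 = y.

Definition simply_connected (S : set point) : Prop :=
  (forall p q, S p -> S q -> exists g : R -> point,
      {within I01, continuous g} /\ g 0 = p /\ g 1 = q /\ g @` I01 `<=` S) /\
  (forall g : R -> point, {within I01, continuous g} -> g @` I01 `<=` S ->
     g 0 = g 1 ->
     exists H : R * R -> point,
       {within [set us : R * R | I01 us.1 /\ I01 us.2], continuous H} /\
       (forall u s, I01 u -> I01 s -> S (H (u, s))) /\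
       (forall s, I01 s -> H (0, s) = g s) /\
       (forall s, I01 s -> H (1, s) = g 0) /\
       (forall u, I01 u -> H (u, 0) = g 0 /\ H (u, 1) = g 0)).

Definition sides (S : set point) (x y : point) (g1 g2 : R -> point) : Prop :=
  arc g1 x y /\ arc g2 x y /\
  (forall s u, I01 s -> I01 u -> g1 s = g2 u -> g1 s = x \/ g1 s = y) /\
  frontier S = g1 @` I01 `|` g2 @` I01.

Definition adornment (S : set point) (x y : point) : Prop :=
  compact S /\ simply_connected S /\ S = closure (interior S) /\
  x <> y /\ frontier S x /\ frontier S y /\ segment x y `<=` S /\
  exists g1 g2, sides S x y g1 g2.

Definition slender_side (g : R -> point) (x y : point) : Prop :=
  forall s u, I01 s -> I01 u -> s <= u ->
    dist (g s) x <= dist (g u) x /\ dist (g u) y <= dist (g s) y.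

Definition slender_adornment (S : set point) (x y : point) : Prop :=
  adornment S x y /\
  exists g1 g2, sides S x y g1 g2 /\ slender_side g1 x y /\ slender_side g2 x y.

Definition rigid_motion (f : point -> point) : Prop :=
  exists c s b1 b2 : R, c ^+ 2 + s ^+ 2 = 1 /\
    forall p : point, f p = (c * p.1 - s * p.2 + b1, s * p.1 + c * p.2 + b2).

Definition overlap (A B : set point) : Prop :=
  exists p, (A p /\ interior B p) \/ (B p /\ interior A p).

(* Polygonal chains with n bars and vertices 0..n; bar k joins vertices k and
   k+1.  A closed chain is encoded by the constraint vertex n = vertex 0.
   A configuration is a map nat -> point (only indices <= n matter). *)

Definition bar_point (X : nat -> point) (k : nat) (l : R) : point :=
  lerp (X k) (X k.+1) l.

Definition expansion (n : nat) (X Y : nat -> point) : Prop :=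
  forall k l (a b : R), (k < n)%N -> (l < n)%N -> I01 a -> I01 b ->
    dist (bar_point X k a) (bar_point X l b) <=
    dist (bar_point Y k a) (bar_point Y l b).

Definition expansive_motion (n : nat) (closed : bool) (C : R -> nat -> point)
  : Prop :=
  (forall i, (i <= n)%N -> {within I01, continuous (fun t => C t i)}) /\
  (closed -> forall t, I01 t -> C t n = C t 0%N) /\
  (forall t k, I01 t -> (k < n)%N ->
     dist (C t k) (C t k.+1) = dist (C 0 k) (C 0 k.+1)) /\
  (forall t t', I01 t -> I01 t' -> t <= t' -> expansion n (C t) (C t')).

End Plane.

Notation plane R := (R * R)%type (only parsing).

(* Main.v *)
(* By slenderness a point [z] of the interior of an adornment lies in an open
   half-lens inside the adornment: the part, on one side of the base line, of the
   intersection of two discs centred at the endpoints of the base, with radii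
   smaller than the length of the base.  If two moved adornments overlap, then so
   do two such half-lenses, and this overlap survives when the motion is run
   backwards: by Kirszbraun's theorem the four discs keep meeting, so the common
   part of the half-lenses, being convex, can only be lost at a base line, i.e.
   (by the bound on the radii) at an interior point of a bar.  A point of a bar
   that lies in the discs of the other bar stays in them, and bars that cross have
   always crossed.  Hence the adornments overlap at time 0. *)

Require Import Defs.
From HB Require Import structures.
From mathcomp Require Import all_boot all_order all_algebra.
From mathcomp Require Import all_classical all_reals all_analysis.
From mathcomp Require Import ring lra.
Set Implicit Arguments. Unset Strict Implicit. Unset Printing Implicit Defensive.
Import Order.TTheory GRing.Theory Num.Theory numFieldNormedType.Exports.
Local Open Scope classical_set_scope.
Local Open Scope ring_scope.

(** * Kirszbraun for discs in the plane *)

(** Kirszbraun compares two single configurations and controls distances only: its common point of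
    the four discs may lie on the wrong side of a base line. The sides are therefore recovered by
    continuity, at the infimum of the times at which the half-lenses meet. The radii are strictly
    smaller than the bases because adjacent bars always touch at their hinge: only a meeting point
    in the relative interior of both bars contradicts the hypothesis at time 0. Squared distances
    keep the inequalities polynomial. *)

Definition sqdist {R : realType} (p q : plane R) : R :=
  (p.1 - q.1) ^+ 2 + (p.2 - q.2) ^+ 2.

Definition bary {R : realType} {m : nat} (c : 'I_m -> plane R) (w : 'rV[R]_m) : plane R :=
  (\sum_i w 0 i * (c i).1, \sum_i w 0 i * (c i).2).

Definition simplex {R : realType} {m : nat} : set 'rV[R]_m :=
  [set w | (forall i, 0 <= w 0 i) /\ \sum_i w 0 i = 1].

(** Parallel axis theorem in one coordinate. The moment about the barycentre is expressed by
    pairwise distances, which is what [contracted_discs_meet] compares between two families of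
    centres. *)
Lemma huygens1 {R : realType} {m : nat} (w : 'rV[R]_m) (a : 'I_m -> R) (z : R) :
  \sum_i w 0 i = 1 ->
  \sum_i w 0 i * (z - a i) ^+ 2 =
    2^-1 * (\sum_i \sum_j w 0 i * w 0 j * (a i - a j) ^+ 2) +
    (z - \sum_i w 0 i * a i) ^+ 2.
Proof.
move=> w1.
set A := \sum_i w 0 i * a i; set B := \sum_i w 0 i * a i ^+ 2.
have expand (A' B' : R) : \sum_i w 0 i * (a i ^+ 2 - 2 * a i * A' + B') = B - 2 * A' * A + B'.
  transitivity (B - 2 * A' * A + B' * \sum_i w 0 i); last by rewrite w1 mulr1.
  rewrite /A /B !mulr_sumr -sumrB -big_split /=.
  by apply: eq_bigr => i _; ring.
have expand_sqr (t : R) : \sum_i w 0 i * (t - a i) ^+ 2 = B - 2 * t * A + t ^+ 2.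
  by rewrite -expand; apply: eq_bigr => i _; ring.
suff -> : \sum_i \sum_j w 0 i * w 0 j * (a i - a j) ^+ 2 = 2 * B - 2 * A ^+ 2.
  by rewrite expand_sqr; field.
transitivity (\sum_i w 0 i * (a i ^+ 2 - 2 * a i * A + B)); last by rewrite expand; ring.
apply: eq_bigr => i _; under eq_bigr do rewrite -mulrA.
by rewrite -mulr_sumr expand_sqr; congr (_ * _); ring.
Qed.

Lemma huygens {R : realType} {m : nat} (w : 'rV[R]_m) (c : 'I_m -> plane R) (z : plane R) :
  \sum_i w 0 i = 1 ->
  \sum_i w 0 i * sqdist z (c i) =
    2^-1 * (\sum_i \sum_j w 0 i * w 0 j * sqdist (c i) (c j)) +
    sqdist z (bary c w).
Proof.
move=> w1; rewrite {3}/sqdist /bary /=.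
transitivity (\sum_i w 0 i * (z.1 - (c i).1) ^+ 2 + \sum_i w 0 i * (z.2 - (c i).2) ^+ 2).
  by rewrite -big_split; apply: eq_bigr => i _; rewrite /= -mulrDr.
rewrite !huygens1//.
suff -> : \sum_i \sum_j w 0 i * w 0 j * sqdist (c i) (c j) =
   \sum_i \sum_j w 0 i * w 0 j * ((c i).1 - (c j).1) ^+ 2 +
   \sum_i \sum_j w 0 i * w 0 j * ((c i).2 - (c j).2) ^+ 2 by ring.
rewrite -big_split; apply: eq_bigr => i _ /=; rewrite -big_split.
by apply: eq_bigr => j _ /=; rewrite -mulrDr.
Qed.

Lemma continuous_addr {R : realType} {T : topologicalType} (f g : T -> R) :
  continuous f -> continuous g -> continuous (fun x => f x + g x).
Proof. by move=> cf cg x; apply: (@cvgD _ R^o); [exact: cf|exact: cg]. Qed.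

Lemma continuous_subr {R : realType} {T : topologicalType} (f g : T -> R) :
  continuous f -> continuous g -> continuous (fun x => f x - g x).
Proof. by move=> cf cg x; apply: (@cvgB _ R^o); [exact: cf|exact: cg]. Qed.

Lemma continuous_mulr {R : realType} {T : topologicalType} (f g : T -> R) :
  continuous f -> continuous g -> continuous (fun x => f x * g x).
Proof. by move=> cf cg x; apply: (@cvgM R T); [exact: cf|exact: cg]. Qed.

Lemma continuous_sumr {R : realType} {T : topologicalType} {I : Type} (s : seq I)
    (f : I -> T -> R) :
  (forall i, continuous (f i)) -> continuous (fun x => \sum_(i <- s) f i x).
Proof.
move=> cf; elim: s => [|i s IH].
  by under eq_fun do rewrite big_nil; move=> x; exact: cvg_cst.
under eq_fun do rewrite big_cons.
by apply: continuous_addr; [exact: cf|exact: IH].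
Qed.

Lemma compact_simplex (R : realType) (m : nat) : compact (@simplex R m).
Proof.
have cc (i : 'I_m) : continuous (fun w : 'rV[R]_m => w 0 i) by exact: coord_continuous.
apply: (@subclosed_compact _ _ [set w : 'rV[R]_m | forall i, `[0, 1]%classic (w 0 i)]).
- rewrite (_ : @simplex R m =
    \bigcap_(i : 'I_m) ((fun w => w 0 i) @^-1` [set x | 0 <= x]) `&`
    (fun w => \sum_i w 0 i) @^-1` [set 1]).
    apply: closedI.
      apply: closed_bigI => i _; apply: closed_comp; last exact: closed_ge.
      by move=> w _; exact: cc.
    apply: closed_comp; last exact: closed_eq.
    by move=> w _; apply: continuous_sumr.
  by apply/seteqP; split=> w [w0 w1]; split => // i; [move=> _|]; exact: w0.
- have := @rV_compact R m (fun=> `[0, 1]%classic) (fun=> @segment_compact _ 0 1).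
  by rewrite (ord1 ord0).
- move=> w [w0 w1] i /=; rewrite in_itv /= w0 /= -w1 (bigD1 i) //= lerDl.
  exact: sumr_ge0.
Qed.

(* Planar Kirszbraun theorem for open discs.  The minimum of the Lagrange dual
   function [G] over the simplex is positive because the discs around [c'] meet;
   the barycentre of a minimiser is the common point of the discs around [c]. *)
Lemma contracted_discs_meet {R : realType} {m : nat} (c c' : 'I_m.+1 -> plane R)
    (r : 'I_m.+1 -> R) (q' : plane R) :
  (forall i j, sqdist (c i) (c j) <= sqdist (c' i) (c' j)) ->
  (forall i, sqdist q' (c' i) < r i) ->
  exists q, forall i, sqdist q (c i) < r i.
Proof.
move=> le_cc' rq'.
pose G (w : 'rV[R]_m.+1) := \sum_i w 0 i * r i -
  2^-1 * \sum_i \sum_j w 0 i * w 0 j * sqdist (c i) (c j).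
(* Hence [G w] is the maximum over [z] of the weighted sum of [r i - sqdist z (c i)], attained at
   the barycentre. *)
have GE z (w : 'rV[R]_m.+1) : \sum_i w 0 i = 1 ->
    G w = \sum_i w 0 i * (r i - sqdist z (c i)) + sqdist z (bary c w).
  move=> w1; under eq_bigr do rewrite mulrBr.
  by rewrite sumrB huygens // /G; ring.
have G_gt0 (w : 'rV[R]_m.+1) : @simplex R m.+1 w -> 0 < G w.
  move=> [w0 w1].
  (* The double sum can only grow when [c] is replaced by [c'], and for [c'] it is bounded by the
     weighted squared distances from [q']. *)
  have : 2^-1 * \sum_i \sum_j w 0 i * w 0 j * sqdist (c i) (c j) <=
      \sum_i w 0 i * sqdist q' (c' i).
    rewrite huygens //; apply: ler_wpDr; first by rewrite addr_ge0 ?sqr_ge0.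
    rewrite ler_wpM2l ?invr_ge0 //; apply: ler_sum => i _; apply: ler_sum => j _.
    by rewrite ler_wpM2l ?mulr_ge0.
  suff : \sum_i w 0 i * sqdist q' (c' i) < \sum_i w 0 i * r i by rewrite /G; lra.
  rewrite -subr_gt0 -sumrB.
  have nn i : 0 <= w 0 i * r i - w 0 i * sqdist q' (c' i).
    by rewrite -mulrBr mulr_ge0 // subr_ge0 ltW.
  rewrite lt0r sumr_ge0 // andbT; apply/eqP => /eqP.
  rewrite psumr_eq0 // => /allP z0.
  suff : \sum_i w 0 i = 0 by rewrite w1 => /eqP; rewrite oner_eq0.
  apply: big1 => i _; have := z0 i (mem_index_enum i).
  rewrite -mulrBr mulf_eq0 => /orP[/eqP //|]; rewrite subr_eq0 => /eqP e.
  by have := rq' i; rewrite e ltxx.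
have [w sw minw] : exists2 w, w \in @simplex R m.+1 &
    forall t, t \in @simplex R m.+1 -> G w <= G t.
  apply: EVT_min_rV.
  - exists (\row_i (i == 0)%:R); split=> [i|]; rewrite ?mxE ?ler0n //.
    rewrite (bigD1 0) //= mxE big1 ?addr0 // => i; rewrite mxE => /negbTE -> //.
  - exact: compact_simplex.
  - apply: continuous_subspaceT.
    have cc (i : 'I_m.+1) : continuous (fun w : 'rV[R]_m.+1 => w 0 i).
      exact: coord_continuous.
    have ck (k : R) : continuous (fun _ : 'rV[R]_m.+1 => k) by exact: cst_continuous.
    apply: continuous_subr.
      by apply: continuous_sumr => i; apply: continuous_mulr.
    apply: continuous_mulr; first exact: ck.
    apply: continuous_sumr => i; apply: continuous_sumr => j.
    by apply: continuous_mulr; [exact: continuous_mulr|exact: ck].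
have /[!inE] -[w0 w1] := sw.
exists (bary c w) => i; set q := bary c w.
have Gw := G_gt0 w (conj w0 w1).
suff : G w <= r i - sqdist q (c i) by lra.
(* Moving the minimiser [w] towards vertex [i] of the simplex by [s] shifts the barycentre by order
   [s], which costs [G] only order [s ^+ 2]; minimality is then divided by [s]. *)
have step s : 0 < s <= 1 -> G w <= r i - sqdist q (c i) + s * sqdist q (c i).
  move=> /andP[s0 s1].
  pose v : 'rV[R]_m.+1 := \row_j ((1 - s) * w 0 j + s * (j == i)%:R).
  have sumv (f : 'I_m.+1 -> R) :
      \sum_j v 0 j * f j = (1 - s) * (\sum_j w 0 j * f j) + s * f i.
    transitivity (\sum_j ((1 - s) * (w 0 j * f j) + s * ((j == i)%:R * f j))).
      by apply: eq_bigr => j _; rewrite mxE; ring.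
    rewrite big_split -!mulr_sumr /=; congr (_ + s * _).
    rewrite (bigD1 i) //= eqxx mul1r big1 ?addr0 // => j /negbTE ->.
    by rewrite mul0r.
  have v1 : \sum_j v 0 j = 1.
    under eq_bigr do rewrite -[v _ _]mulr1.
    by rewrite sumv; under eq_bigr do rewrite mulr1; rewrite w1; ring.
  have sv : v \in @simplex R m.+1.
    rewrite inE; split => // j; rewrite mxE addr_ge0 // mulr_ge0 ?subr_ge0 //.
    exact: ltW.
  have := minw v sv; rewrite (GE q v v1) (GE q w w1) sumv.
  have -> : sqdist q (bary c v) = s ^+ 2 * sqdist q (c i).
    by rewrite /bary !sumv /sqdist /q /bary /=; ring.
  have -> : sqdist q (bary c w) = 0 by rewrite /sqdist !subrr; ring.
  set F := \sum_j _; set d := sqdist q (c i); set e := r i - d => h.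
  by rewrite -(ler_pM2l s0); nra.
have d0 : 0 <= sqdist q (c i) by rewrite addr_ge0 ?sqr_ge0.
apply/ler_addgt0Pr => e e0.
(* Makes [s * (sqdist q (c i) + 1) <= e]; the [+ 1] allows for a zero distance. *)
pose s := Num.min 1 (e / (sqdist q (c i) + 1)).
have d1 : 0 < sqdist q (c i) + 1 by lra.
have s0 : 0 < s by rewrite lt_min ltr01 divr_gt0.
have /step /le_trans -> // : 0 < s <= 1 by rewrite s0 ge_min lexx.
rewrite lerD2l; apply: (@le_trans _ _ (s * (sqdist q (c i) + 1))); first by nra.
by rewrite -ler_pdivlMr // ge_min lexx orbT.
Qed.

(** * Coordinates along and across a base *)

Lemma sqdist_ge0 {R : realType} (p q : plane R) : 0 <= sqdist p q.
Proof. by rewrite addr_ge0 ?sqr_ge0. Qed.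

Lemma sqdistC {R : realType} (p q : plane R) : sqdist p q = sqdist q p.
Proof. by rewrite /sqdist; ring. Qed.

Lemma sqdist_gt0 {R : realType} (p q : plane R) : p <> q -> 0 < sqdist p q.
Proof.
case: p q => [p1 p2] [q1 q2] pq; rewrite lt0r sqdist_ge0 andbT.
apply/eqP => /eqP; rewrite paddr_eq0 ?sqr_ge0 // !sqrf_eq0 !subr_eq0 /=.
by move=> /andP[/eqP e1 /eqP e2]; apply: pq; rewrite e1 e2.
Qed.

Lemma ler_dist {R : realType} (p q p' q' : plane R) :
  (dist p q <= dist p' q') = (sqdist p q <= sqdist p' q').
Proof. by rewrite /dist ler_sqrt // sqdist_ge0. Qed.

Lemma dist_sqdist {R : realType} (p q p' q' : plane R) :
  dist p q = dist p' q' -> sqdist p q = sqdist p' q'.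
Proof. by move=> e; apply/eqP; rewrite eq_le -!ler_dist e lexx. Qed.

Lemma lerp0 {R : realType} (a b : plane R) : lerp a b 0 = a.
Proof. by rewrite /lerp subr0 !mul1r !mul0r !addr0 -surjective_pairing. Qed.

Lemma lerp1 {R : realType} (a b : plane R) : lerp a b 1 = b.
Proof. by rewrite /lerp subrr !mul1r !mul0r !add0r -surjective_pairing. Qed.

Lemma I01_0 {R : realType} : @I01 R 0. Proof. by rewrite /I01 /= lexx ler01. Qed.

Lemma I01_1 {R : realType} : @I01 R 1. Proof. by rewrite /I01 /= lexx ler01. Qed.

Lemma sqdist_lerp {R : realType} (a b c : plane R) (l : R) :
  sqdist (lerp a b l) c =
  (1 - l) * sqdist a c + l * sqdist b c - l * (1 - l) * sqdist a b.
Proof. by rewrite /sqdist /lerp /=; ring. Qed.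

(** Signed height over the base line, times the base length; [along] is the projection onto the
    base, scaled likewise. The scaling avoids square roots. *)
Definition cross {R : realType} (x y q : plane R) : R :=
  (y.1 - x.1) * (q.2 - x.2) - (y.2 - x.2) * (q.1 - x.1).

Definition along {R : realType} (x y q : plane R) : R :=
  (y.1 - x.1) * (q.1 - x.1) + (y.2 - x.2) * (q.2 - x.2).

Definition rise {R : realType} (x y p : plane R) (t : R) : plane R :=
  (p.1 - t * (y.2 - x.2), p.2 + t * (y.1 - x.1)).

Lemma cross_rise {R : realType} (x y p : plane R) (t : R) :
  cross x y (rise x y p t) = cross x y p + t * sqdist x y.
Proof. by rewrite /cross /rise /sqdist /=; ring. Qed.

Lemma along_rise {R : realType} (x y p : plane R) (t : R) :
  along x y (rise x y p t) = along x y p.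
Proof. by rewrite /along /rise /=; ring. Qed.

Lemma cross_lerp {R : realType} (x y a b : plane R) (l : R) :
  cross x y (lerp a b l) = (1 - l) * cross x y a + l * cross x y b.
Proof. by rewrite /cross /lerp /=; ring. Qed.

Lemma cross_base {R : realType} (x y : plane R) (l : R) : cross x y (lerp x y l) = 0.
Proof. by rewrite /cross /lerp /=; ring. Qed.

Lemma along_base {R : realType} (x y : plane R) (l : R) :
  along x y (lerp x y l) = l * sqdist x y.
Proof. by rewrite /along /lerp /sqdist /=; ring. Qed.

Lemma along_sqdist {R : realType} (x y q : plane R) :
  2 * along x y q = sqdist q x - sqdist q y + sqdist x y.
Proof. by rewrite /along /sqdist; ring. Qed.

Lemma along_cross_sqdist_l {R : realType} (x y q : plane R) :
  along x y q ^+ 2 + cross x y q ^+ 2 = sqdist x y * sqdist q x.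
Proof. by rewrite /along /cross /sqdist; ring. Qed.

Lemma along_cross_sqdist_r {R : realType} (x y q : plane R) :
  (sqdist x y - along x y q) ^+ 2 + cross x y q ^+ 2 = sqdist x y * sqdist q y.
Proof. by rewrite /along /cross /sqdist; ring. Qed.

Lemma along_cross_inj {R : realType} (x y p q : plane R) : x <> y ->
  along x y p = along x y q -> cross x y p = cross x y q -> p = q.
Proof.
move=> /sqdist_gt0 D0 ea ec; have nz : sqdist x y != 0 by rewrite gt_eqF.
have key w : w = (x.1 + ((y.1 - x.1) * along x y w - (y.2 - x.2) * cross x y w) / sqdist x y,
                  x.2 + ((y.2 - x.2) * along x y w + (y.1 - x.1) * cross x y w) / sqdist x y).
  case: w => w1 w2 /=; congr (_, _); apply: (mulfI nz);
    rewrite mulrDr mulrCA divff // mulr1 /along /cross /sqdist /=; ring.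
by rewrite (key p) (key q) ea ec.
Qed.

Lemma continuous_cross {R : realType} (x y : plane R) : continuous (cross x y).
Proof.
have c1 : continuous (fun q : plane R => q.1) by move=> q; exact: cvg_fst.
have c2 : continuous (fun q : plane R => q.2) by move=> q; exact: cvg_snd.
have ck (k : R) : continuous (fun _ : plane R => k) by exact: cst_continuous.
by apply: continuous_subr; apply: continuous_mulr => //; apply: continuous_subr.
Qed.

Lemma continuous_along {R : realType} (x y : plane R) : continuous (along x y).
Proof.
have c1 : continuous (fun q : plane R => q.1) by move=> q; exact: cvg_fst.
have c2 : continuous (fun q : plane R => q.2) by move=> q; exact: cvg_snd.
have ck (k : R) : continuous (fun _ : plane R => k) by exact: cst_continuous.
by apply: continuous_addr; apply: continuous_mulr => //; apply: continuous_subr.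
Qed.

(** Precomposition with this retraction turns continuity within [I01] into continuity on all of
    [R]. *)
Definition clamp01 {R : realType} (t : R) : R := Num.max 0 (Num.min 1 t).

Lemma clamp01_in {R : realType} (t : R) : I01 (clamp01 t).
Proof. by rewrite /I01 /= /clamp01 le_max lexx ge_max ler01 ge_min lexx. Qed.

Lemma clamp01_id {R : realType} (t : R) : I01 t -> clamp01 t = t.
Proof. by move=> /andP[t0 t1]; rewrite /clamp01 min_r // max_r. Qed.

Lemma continuous_clamp01 {R : realType} : continuous (@clamp01 R).
Proof.
have -> : @clamp01 R = (fun=> 0 : R^o) \max ((fun=> 1 : R^o) \min (fun t => t : R^o)).
  by apply/funext => t.
move=> t; apply: continuous_max; first exact: cst_continuous.
by apply: continuous_min; [exact: cst_continuous|exact: cvg_id].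
Qed.

Lemma continuous_clamp {R : realType} {T : topologicalType} (g : R -> T) :
  {within (@I01 R), continuous g} -> continuous (g \o clamp01).
Proof.
move=> /subspace_continuousP cg t U /(cg _ (clamp01_in t)) nU.
have near_c : \forall s \near clamp01 t, I01 s -> U (g s) by exact: nU.
have : \forall s \near t, I01 (clamp01 s) -> U (g (clamp01 s)).
  by have := @continuous_clamp01 R t; rewrite /continuous_at => /(_ _ near_c).
by apply: filterS => s; apply; exact: clamp01_in.
Qed.

Lemma continuous_pairing {T U V : topologicalType} (f : T -> U) (g : T -> V) :
  continuous f -> continuous g -> continuous (fun x => (f x, g x)).
Proof. by move=> cf cg x; apply: cvg_pair; [exact: cf|exact: cg]. Qed.

Lemma continuous_lerp {R : realType} (a b : plane R) : continuous (lerp a b).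
Proof.
have ck (k : R) : continuous (fun _ : R => k) by exact: cst_continuous.
have ci : continuous (fun l : R => l) by move=> ?; exact: cvg_id.
apply: continuous_pairing.
  by apply: continuous_addr; apply: continuous_mulr => //; apply: continuous_subr.
by apply: continuous_addr; apply: continuous_mulr => //; apply: continuous_subr.
Qed.

(** If the segment avoided the frontier, the parameters whose point lies in [S] would be both open
    and closed in the connected set [I01]. *)
Lemma segment_meets_frontier {R : realType} (S : set (plane R)) (a b : plane R) :
  closed S -> interior S a -> ~ S b -> exists2 l : R, I01 l & frontier S (lerp a b l).
Proof.
move=> cS Sa Sb; apply: contrapT => nf.
have I01E : @I01 R = `[0, 1]%classic.
  by apply/seteqP; split=> t /=; rewrite in_itv.
have nfr l : I01 l -> S (lerp a b l) -> interior S (lerp a b l).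
  move=> l01 Sl; apply: contrapT => nl; apply: nf; exists l => //.
  by split=> //; exact: subset_closure.
have cl := @continuous_lerp R a b.
have : @I01 R `&` lerp a b @^-1` S = @I01 R.
  have := @segment_connected R 0 1; rewrite -I01E; apply.
  - exists 0; split; first exact: I01_0.
    by rewrite /preimage /= lerp0; exact: interior_subset.
    - exists (lerp a b @^-1` interior S); first by apply: open_comp; [move=> t _; exact: cl|exact: open_interior].
    apply/seteqP; split=> t [t01 h]; split=> //; first exact: (nfr _ t01 h).
    exact: (@interior_subset _ S _ h).
    - by exists (lerp a b @^-1` S) => //; apply: closed_comp => // t _; exact: cl.
move=> h; apply: Sb; have := @I01_1 R; rewrite -h => -[_].
by rewrite /preimage /= lerp1.
Qed.

(** * Slender sides *)

Lemma slender_side_sqdist {R : realType} (g : R -> plane R) (x y : plane R) (s u : R) :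
  slender_side g x y -> I01 s -> I01 u -> s <= u ->
  sqdist (g s) x <= sqdist (g u) x /\ sqdist (g u) y <= sqdist (g s) y.
Proof. by move=> sl Is Iu /(sl _ _ Is Iu) []; rewrite !ler_dist. Qed.

(* If [along] agreed at two parameters then both distances to [x] and [y] would be
   constant in between, leaving only two possible positions, one on each side of
   the base, for three distinct points of the arc. *)
Lemma slender_along_lt {R : realType} (g : R -> plane R) (x y : plane R) (s u : R) :
  x <> y -> Defs.arc g x y -> slender_side g x y -> I01 s -> I01 u -> s < u ->
  along x y (g s) < along x y (g u).
Proof.
move=> xy [_ [inj _]] sl Is Iu su.
have [su1 su2] := slender_side_sqdist sl Is Iu (ltW su).
have es := along_sqdist x y (g s); have eu := along_sqdist x y (g u).
rewrite lt_neqAle; apply/andP; split; last by lra.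
apply/eqP => e.
pose m := (s + u) / 2.
have sm : s < m by rewrite /m; lra.
have mu : m < u by rewrite /m; lra.
have Im : I01 m by move: Is Iu; rewrite /I01 /= => /andP[? ?] /andP[? ?]; lra.
have [sm1 sm2] := slender_side_sqdist sl Is Im (ltW sm).
have [mu1 mu2] := slender_side_sqdist sl Im Iu (ltW mu).
have em := along_sqdist x y (g m).
have ssm : sqdist (g s) x = sqdist (g m) x by lra.
have smu : sqdist (g m) x = sqdist (g u) x by lra.
have asm : along x y (g s) = along x y (g m) by lra.
have amu : along x y (g m) = along x y (g u) by lra.
have cs := along_cross_sqdist_l x y (g s).
have cm := along_cross_sqdist_l x y (g m).
have cu := along_cross_sqdist_l x y (g u).
have csm : cross x y (g s) ^+ 2 = cross x y (g m) ^+ 2 by rewrite asm ssm in cs; lra.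
have cmu : cross x y (g m) ^+ 2 = cross x y (g u) ^+ 2 by rewrite amu smu in cm; lra.
move/eqP: csm; rewrite eqf_sqr => /orP[/eqP h|/eqP h].
  have := inj _ _ Is Im (along_cross_inj xy asm h); lra.
move/eqP: cmu; rewrite eqf_sqr => /orP[/eqP k|/eqP k].
  have := inj _ _ Im Iu (along_cross_inj xy amu k); lra.
have su' : along x y (g s) = along x y (g u) by rewrite asm.
have := inj _ _ Is Iu (along_cross_inj xy su' (etrans h _)); rewrite k opprK => /(_ erefl); lra.
Qed.

(** In the scaled coordinates a slender side is the graph of a continuous function over the base:
    [along] increases strictly along the side, and its inverse [psi], being monotone and onto, has
    no jumps. *)
Lemma slender_height {R : realType} (g : R -> plane R) (x y : plane R) :
  x <> y -> Defs.arc g x y -> slender_side g x y ->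
  exists h : R -> R, {within `[0, sqdist x y], continuous h} /\
    forall a, 0 <= a <= sqdist x y ->
      exists u, [/\ I01 u, along x y (g u) = a & cross x y (g u) = h a].
Proof.
move=> xy ag sl; have alt := slender_along_lt xy ag sl.
have [cg [inj [g0 g1]]] := ag; have D0 := sqdist_gt0 xy.
pose G := g \o clamp01; have cG : continuous G by exact: continuous_clamp.
have Gg u : I01 u -> G u = g u by move=> Iu; rewrite /G /= clamp01_id.
have I0 := @I01_0 R.
have I1 := @I01_1 R.
have al0 : along x y (G 0) = 0 by rewrite Gg // g0 /along !subrr !mulr0 addr0.
have al1 : along x y (G 1) = sqdist x y by rewrite Gg // g1 /along /sqdist; ring.
have caG : continuous (along x y \o G).
  by move=> u; apply: continuous_comp; [exact: cG|exact: continuous_along].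
(* The range condition sits inside the existential, so that choice yields a total function; its
   values off the base are arbitrary. *)
have ex a : exists u, 0 <= a <= sqdist x y -> I01 u /\ along x y (G u) = a.
  have [ha|ha] := boolP (0 <= a <= sqdist x y); last by exists 0.
  have := @IVT R (along x y \o G) 0 1 a ler01 (continuous_subspaceT caG).
  rewrite /= al0 al1 (min_l (ltW D0)) (max_r (ltW D0)) => /(_ ha) [u uI e].
  by exists u => _; split => //; move: uI; rewrite in_itv.
pose psi a := sval (cid (ex a)).
have psiP a : 0 <= a <= sqdist x y -> I01 (psi a) /\ along x y (G (psi a)) = a.
  by rewrite /psi; case: cid.
have altG s u : I01 s -> I01 u -> s < u -> along x y (G s) < along x y (G u).
  by move=> Is Iu su; rewrite !Gg //; exact: alt.
have ainj s u : I01 s -> I01 u -> along x y (G s) = along x y (G u) -> s = u.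
  move=> Is Iu e; case: (ltgtP s u) => // su.
    by have := altG _ _ Is Iu su; rewrite e ltxx.
  by have := altG _ _ Iu Is su; rewrite e ltxx.
have cpsi : {within `[0, sqdist x y], continuous psi}.
  apply: segment_inc_surj_continuous.
    move=> a b; rewrite !in_itv /= => /psiP [Ia ea] /psiP [Ib eb].
    case: (ltgtP (psi a) (psi b)) => [h|h|h].
    - by have := altG _ _ Ia Ib h; rewrite ea eb => /ltW ->.
    - by have := altG _ _ Ib Ia h; rewrite ea eb leNgt => ->.
    - by move: ea; rewrite h eb => ->; rewrite lexx.
  have p0 : psi 0 = 0.
    have [|Ia ea] := psiP 0; first by rewrite lexx ltW.
    by apply: ainj => //; rewrite ea al0.
  have p1 : psi (sqdist x y) = 1.
    have [|Ia ea] := psiP (sqdist x y); first by rewrite lexx ltW.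
    by apply: ainj => //; rewrite ea al1.
  rewrite p0 p1 => u /=; rewrite in_itv /= => Iu.
  have ha : 0 <= along x y (G u) <= sqdist x y.
    have /andP[u0 u1] := Iu; apply/andP; split.
      move: u0; rewrite le_eqVlt => /orP[/eqP <-|u0]; first by rewrite al0.
      by rewrite -al0 ltW // altG.
    move: u1; rewrite le_eqVlt => /orP[/eqP ->|u1]; first by rewrite al1.
    by rewrite -al1 ltW // altG.
  exists (along x y (G u)); first by rewrite /= in_itv.
  by have [Ia ea] := psiP _ ha; exact: ainj.
exists ((cross x y \o G) \o psi); split.
  apply: within_continuous_comp cpsi => u _.
  by apply: continuous_comp; [exact: cG|exact: continuous_cross].
by move=> a /psiP [Ia ea]; exists (psi a); rewrite -Gg.
Qed.

Lemma continuous_bounded_on_compact {R : realType} (S : set (plane R)) (f : plane R -> R) :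
  compact S -> continuous f -> exists M, forall q, S q -> f q <= M.
Proof.
move=> cS cf; have [[p Sp]|nS] := pselect (S !=set0); last first.
  by exists 0 => q Sq; exfalso; apply: nS; exists q.
have [||c _ hc] := @compact_EVT_max _ R f S _ cS; first by exists p.
  exact: continuous_subspaceT.
by exists (f c) => q Sq; apply: hc; rewrite inE.
Qed.

Lemma ray_meets_frontier {R : realType} (S : set (plane R)) (x y z : plane R) (s : R) :
  x <> y -> s ^+ 2 = 1 -> compact S -> interior S z ->
  exists2 t, 0 < t & frontier S (rise x y z (s * t)).
Proof.
move=> xy s1 cS Sz; have D0 := sqdist_gt0 xy.
have clS : closed S by apply: compact_closed => //; exact: norm_hausdorff.
have [M hM] : exists M, forall q, S q -> s * cross x y q <= M.
  apply: continuous_bounded_on_compact => //; apply: continuous_mulr.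
    exact: cst_continuous.
  exact: continuous_cross.
(* At this parameter the scaled height exceeds the bound [M], so the ray has left [S]. *)
pose T := (`|M - s * cross x y z| + 1) / sqdist x y.
have T0 : 0 < T by rewrite divr_gt0 // ltr_wpDl.
have nST : ~ S (rise x y z (s * T)).
  move=> /hM; rewrite cross_rise mulrDr -mulrA mulrA -expr2 s1 mul1r.
  rewrite /T divfK ?gt_eqF //.
  by have := ler_norm (M - s * cross x y z); lra.
have [l Il fl] := segment_meets_frontier clS Sz nST.
have sE : lerp z (rise x y z (s * T)) l = rise x y z (s * (l * T)).
  by rewrite /lerp /rise /=; congr (_, _); ring.
exists (l * T); last by rewrite -sE.
have /andP[l0 _] := Il; move: l0; rewrite le_eqVlt => /orP[/eqP l0|l0].
  by case: fl => _; case; rewrite -l0 lerp0.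
exact: mulr_gt0.
Qed.

(* Otherwise the two sides, being graphs over the base, would either cross or both
   pass strictly above some base point, and the base would leave [S]. *)
Lemma sides_not_both_above {R : realType} (S : set (plane R)) (x y : plane R)
    (g1 g2 : R -> plane R) (s u1 u2 : R) :
  x <> y -> s ^+ 2 = 1 -> compact S -> segment x y `<=` S -> sides S x y g1 g2 ->
  slender_side g1 x y -> slender_side g2 x y -> I01 u1 -> I01 u2 ->
  0 < s * cross x y (g1 u1) -> 0 < s * cross x y (g2 u2) -> False.
Proof.
move=> xy s1 cS base [a1 [a2 [disj fS]]] sl1 sl2 Iu1 Iu2 pos1 pos2.
have D0 := sqdist_gt0 xy.
have ainj g : Defs.arc g x y -> slender_side g x y -> forall a b, I01 a -> I01 b ->
    along x y (g a) = along x y (g b) -> a = b.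
  move=> ag sl a b Ia Ib e; case: (ltgtP a b) => // ab.
    by have := slender_along_lt xy ag sl Ia Ib ab; rewrite e ltxx.
  by have := slender_along_lt xy ag sl Ib Ia ab; rewrite e ltxx.
have range g : Defs.arc g x y -> slender_side g x y -> forall a, I01 a ->
    0 <= along x y (g a) <= sqdist x y.
  move=> ag sl a Ia.
  have I0 := @I01_0 R.
  have I1 := @I01_1 R.
  have [_ [_ [g0 g1']]] := ag; have /andP[ge0 le1] := Ia.
  have al0 : along x y x = 0 by rewrite /along !subrr !mulr0 addr0.
  have al1 : along x y y = sqdist x y by rewrite /along /sqdist; ring.
  apply/andP; split.
    move: ge0; rewrite le_eqVlt => /orP[/eqP <-|h]; first by rewrite g0 al0.
    by have := slender_along_lt xy ag sl I0 Ia h; rewrite g0 al0 => /ltW.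
  move: le1; rewrite le_eqVlt => /orP[/eqP ->|h]; first by rewrite g1' al1.
  by have := slender_along_lt xy ag sl Ia I1 h; rewrite g1' al1 => /ltW.
(* With both sides above the base point [b], every frontier point on the perpendicular through [b]
   lies above it. So [b] is interior, and the ray from [b] to the other side would have to leave [S]
   without meeting the frontier. *)
have notboth u v : I01 u -> I01 v -> along x y (g1 u) = along x y (g2 v) ->
    0 < s * cross x y (g1 u) -> 0 < s * cross x y (g2 v) -> False.
  move=> Iu Iv e pu pv.
  have ra := range _ a1 sl1 _ Iu.
  pose b := lerp x y (along x y (g1 u) / sqdist x y).
  have ab : along x y b = along x y (g1 u) by rewrite along_base divfK ?gt_eqF.
  have cb : cross x y b = 0 by exact: cross_base.
  have onfrontier q : frontier S q -> along x y q = along x y (g1 u) -> 0 < s * cross x y q.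
    rewrite fS => -[] [w Iw <-] eq.
      by rewrite (ainj _ a1 sl1 _ _ Iw Iu eq).
    by rewrite (ainj _ a2 sl2 _ _ Iw Iv (etrans eq e)).
  have Sb : S b.
    apply: base; exists (along x y (g1 u) / sqdist x y) => //.
    have /andP[r0 r1] := ra.
    by apply/andP; split; [exact: divr_ge0 r0 (ltW D0)|rewrite ler_pdivrMr // mul1r].
  have iSb : interior S b.
    apply: contrapT => nb; have := onfrontier b; rewrite cb mulr0 ltxx => h.
    by suff: false by []; apply: h => //; split => //; exact: subset_closure.
  have s1' : (- s) ^+ 2 = 1 by rewrite sqrrN.
  have [t t0 ft] := ray_meets_frontier xy s1' cS iSb.
  have := onfrontier _ ft; rewrite along_rise ab cross_rise cb add0r => /(_ erefl).
  rewrite mulrA mulrA mulrN -expr2 s1 mulN1r; have := mulr_gt0 t0 D0; lra.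
have [h1 [ch1 h1P]] := slender_height xy a1 sl1.
have [h2 [ch2 h2P]] := slender_height xy a2 sl2.
have nb a : 0 <= a <= sqdist x y -> 0 < s * h1 a -> 0 < s * h2 a -> False.
  move=> ra; have [u [Iu eu <-]] := h1P _ ra; have [v [Iv ev <-]] := h2P _ ra.
  by apply: notboth => //; rewrite eu ev.
(* Equal heights would give a common point of the two sides other than [x] and [y]. *)
have nz a : 0 < a < sqdist x y -> h1 a <> h2 a.
  move=> /andP[a0 aD]; have ra : 0 <= a <= sqdist x y by rewrite !ltW.
  have [u [Iu eu <-]] := h1P _ ra; have [v [Iv ev <-]] := h2P _ ra.
  move=> ce; have [] : g1 u = x \/ g1 u = y.
    by apply: (disj _ v) => //; apply: (along_cross_inj xy) => //; rewrite eu ev.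
  - by move=> e; move: eu; rewrite e /along !subrr !mulr0 addr0 => e0; rewrite -e0 ltxx in a0.
  - move=> e; move: eu; rewrite e => e0.
    have : along x y y = sqdist x y by rewrite /along /sqdist; ring.
    by rewrite e0 => e1; rewrite e1 ltxx in aD.
(* By [nb] the second side is not above the base over [b1], nor the first over [b2], so [k] changes
   sign between [b1] and [b2]; its zero there contradicts [nz]. *)
pose k a := s * h1 a - s * h2 a.
have ck : {within `[0, sqdist x y], continuous k}.
  by apply: continuous_subr; apply: continuous_mulr => //; exact: cst_continuous.
pose b1 := along x y (g1 u1); pose b2 := along x y (g2 u2).
have r1 : 0 <= b1 <= sqdist x y by exact: range.
have r2 : 0 <= b2 <= sqdist x y by exact: range.
have k1 : 0 < k b1.
  have [u [Iu eu hu]] := h1P _ r1; have hb := nb _ r1.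
  have e1 : s * h1 b1 = s * cross x y (g1 u1) by rewrite -hu (ainj _ a1 sl1 _ _ Iu Iu1 eu).
  rewrite /k; move: hb; rewrite e1 => /(_ pos1) /negP; rewrite -leNgt; lra.
have k2 : k b2 < 0.
  have [u [Iu eu hu]] := h2P _ r2; have hb := nb _ r2.
  have e1 : s * h2 b2 = s * cross x y (g2 u2) by rewrite -hu (ainj _ a2 sl2 _ _ Iu Iu2 eu).
  rewrite /k; move: hb; rewrite e1 => hb.
  have /negP : ~ 0 < s * h1 b2 by move=> h; exact: hb.
  by rewrite -leNgt; lra.
have nzk c : 0 < c < sqdist x y -> k c <> 0.
  move=> /nz hc kc; apply: hc; have s0 : s != 0.
    by apply/eqP => s0; move: s1; rewrite s0 expr0n => /eqP; rewrite eq_sym oner_eq0.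
  by apply: (mulfI s0); move: kc; rewrite /k => /eqP; rewrite subr_eq0 => /eqP.
have sub a b : 0 <= a -> b <= sqdist x y -> {within `[a, b], continuous k}.
  move=> a0 bD; apply: continuous_subspaceW ck => w /=; rewrite !in_itv /= => /andP[? ?].
  by apply/andP; split; lra.
have noroot c : 0 <= c <= sqdist x y -> k c = 0 -> b1 < c < b2 \/ b2 < c < b1 -> False.
  move=> /andP[c0 cD] kc h; apply: (nzk c) => //.
  by move: h r1 r2 => [] /andP[? ?] /andP[? ?] /andP[? ?]; apply/andP; split; lra.
move: r1 r2 => /andP[p1 q1] /andP[p2 q2].
have neq1 c : k c = 0 -> c != b1 by move=> kc; apply/eqP => e; rewrite -e kc ltxx in k1.
have neq2 c : k c = 0 -> c != b2 by move=> kc; apply/eqP => e; rewrite -e kc ltxx in k2.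
case: (leP b1 b2) => b12.
  have := @IVT R k b1 b2 0 b12 (sub _ _ p1 q2).
  rewrite min_r ?max_l ?(le_trans (ltW k2) (ltW k1)) // (ltW k1) (ltW k2).
  move=> /(_ isT) [c]; rewrite in_itv /= => /andP[c1 c2] kc.
  apply: (noroot c _ kc); first by rewrite (le_trans p1 c1) (le_trans c2 q2).
  by left; rewrite !lt_neqAle c1 c2 (neq2 _ kc) eq_sym (neq1 _ kc).
have := @IVT R k b2 b1 0 (ltW b12) (sub _ _ p2 q1).
rewrite min_l ?max_r ?(le_trans (ltW k2) (ltW k1)) // (ltW k1) (ltW k2).
move=> /(_ isT) [c]; rewrite in_itv /= => /andP[c1 c2] kc.
apply: (noroot c _ kc); first by rewrite (le_trans p2 c1) (le_trans c2 q1).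
by right; rewrite !lt_neqAle c1 c2 (neq1 _ kc) eq_sym (neq2 _ kc).
Qed.

(** [r1] and [r2] are squared radii; [s], always 1 or -1 in use, selects the side of the base
    line. *)
Definition half_lens {R : realType} (s : R) (x y : plane R) (r1 r2 : R) : set (plane R) :=
  [set q | [/\ sqdist q x < r1, sqdist q y < r2 & 0 < s * cross x y q]].

Lemma sqdist_lerp_lt {R : realType} (a b c : plane R) (l r : R) :
  0 <= l -> l <= 1 -> sqdist a c < r -> sqdist b c < r -> sqdist (lerp a b l) c < r.
Proof.
move=> l0 l1 ha hb; rewrite sqdist_lerp.
have := mulr_ge0 (mulr_ge0 l0 (_ : 0 <= 1 - l)) (sqdist_ge0 a b).
rewrite subr_ge0 => /(_ l1) h.
have : (1 - l) * sqdist a c + l * sqdist b c < r.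
  (* One of the two weights is at least one half, which keeps the inequality strict. *)
  have [l05|l05] := leP l (1 / 2); nra.
lra.
Qed.

Lemma half_lens_lerp {R : realType} (s : R) (x y : plane R) (r1 r2 l : R) (a b : plane R) :
  half_lens s x y r1 r2 a -> half_lens s x y r1 r2 b -> I01 l ->
  half_lens s x y r1 r2 (lerp a b l).
Proof.
move=> [a1 a2 a3] [b1 b2 b3] /andP[l0 l1]; split.
- exact: sqdist_lerp_lt.
- exact: sqdist_lerp_lt.
- rewrite cross_lerp mulrDr !(mulrCA s).
  by have [l05|l05] := leP l (1 / 2); nra.
Qed.

(* Slenderness enters here: a frontier point [g u] straight above [z] bounds a
   half-lens that the side [g] cannot enter, since before [u] it is too far from
   [y] and after [u] too far from [x]. *)
Lemma slender_half_lens {R : realType} (S : set (plane R)) (x y z : plane R) (s : R) :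
  slender_adornment S x y -> s ^+ 2 = 1 -> interior S z -> 0 < s * cross x y z ->
  exists r1 r2, [/\ r1 < sqdist x y, r2 < sqdist x y,
    half_lens s x y r1 r2 z & half_lens s x y r1 r2 `<=` S].
Proof.
move=> [[cS [_ [_ [xy [_ [_ [base _]]]]]]] [g1 [g2 [sd [sl1 sl2]]]]] s1 Sz cz.
have D0 := sqdist_gt0 xy.
have clS : closed S by apply: compact_closed => //; exact: norm_hausdorff.
have [t t0 ft] := ray_meets_frontier xy s1 cS Sz.
set p := rise x y z (s * t) in ft.
(* The radii are the distances of the midpoint [w] of [z] and [p]: [z] is then strictly inside, and
   the radii are strictly smaller than the distances of [p], which monotonicity along the side
   bounds by the base length. *)
pose w := rise x y z (s * (t / 2)).
have cp : s * cross x y p = s * cross x y z + t * sqdist x y.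
  by rewrite cross_rise mulrDr !mulrA -expr2 s1 mul1r.
have cw : s * cross x y w = s * cross x y z + t / 2 * sqdist x y.
  by rewrite cross_rise mulrDr !mulrA -expr2 s1 mul1r.
have sqc q : (s * cross x y q) ^+ 2 = cross x y q ^+ 2 by rewrite exprMn s1 mul1r.
have tD : 0 < t * sqdist x y by exact: mulr_gt0.
have zw2 : cross x y z ^+ 2 < cross x y w ^+ 2.
  by rewrite -(sqc z) -(sqc w) ltr_pXn2r ?nnegrE //; lra.
have wp2 : cross x y w ^+ 2 < cross x y p ^+ 2.
  by rewrite -(sqc w) -(sqc p) ltr_pXn2r ?nnegrE //; lra.
have lt_x a b : along x y a = along x y b -> cross x y a ^+ 2 < cross x y b ^+ 2 ->
    sqdist a x < sqdist b x.
  move=> e h; rewrite -(ltr_pM2l D0) -!along_cross_sqdist_l e; lra.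
have lt_y a b : along x y a = along x y b -> cross x y a ^+ 2 < cross x y b ^+ 2 ->
    sqdist a y < sqdist b y.
  move=> e h; rewrite -(ltr_pM2l D0) -!along_cross_sqdist_r e; lra.
have azw : along x y z = along x y w by rewrite along_rise.
have awp : along x y w = along x y p by rewrite !along_rise.
have side_bound g u : Defs.arc g x y -> slender_side g x y -> I01 u -> g u = p ->
    [/\ sqdist p x <= sqdist x y, sqdist p y <= sqdist x y &
     forall v, I01 v -> sqdist w x <= sqdist (g v) x \/ sqdist w y <= sqdist (g v) y].
  move=> [_ [_ [g0 g1']]] sl Iu gu; have /andP[u0 u1] := Iu.
  have I0 := @I01_0 R.
  have I1 := @I01_1 R.
  have [h1 _] := slender_side_sqdist sl Iu I1 u1.
  have [_ h2] := slender_side_sqdist sl I0 Iu u0.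
  rewrite gu g1' in h1; rewrite gu g0 in h2.
  split; [by rewrite [leRHS]sqdistC|by []|move=> v Iv].
  have [vu|uv] := leP v u.
    right; have [_ h] := slender_side_sqdist sl Iv Iu vu; rewrite gu in h.
    exact: le_trans (ltW (lt_y _ _ awp wp2)) h.
  left; have [h _] := slender_side_sqdist sl Iu Iv (ltW uv); rewrite gu in h.
  exact: le_trans (ltW (lt_x _ _ awp wp2)) h.
have [a1 [a2 [disj fS]]] := sd.
have pp : 0 < s * cross x y p by lra.
(* By [sides_not_both_above] all frontier points above the base belong to the side through [p], so
   the estimate along that side covers them. *)
have key : [/\ sqdist p x <= sqdist x y, sqdist p y <= sqdist x y &
    forall q, frontier S q -> 0 < s * cross x y q ->
      sqdist w x <= sqdist q x \/ sqdist w y <= sqdist q y].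
  move: ft; rewrite {1}fS => -[] [u Iu gu].
    have [h1 h2 h3] := side_bound _ _ a1 sl1 Iu gu.
    split => // q; rewrite fS => -[] [v Iv <-] pq; first exact: h3.
    exfalso; apply: (sides_not_both_above xy s1 cS base sd sl1 sl2 Iu Iv) => //.
    by rewrite gu.
  have [h1 h2 h3] := side_bound _ _ a2 sl2 Iu gu.
  split => // q; rewrite fS => -[] [v Iv <-] pq; last exact: h3.
  exfalso; apply: (sides_not_both_above xy s1 cS base sd sl1 sl2 Iv Iu) => //.
  by rewrite gu.
have [px py away] := key.
have hz : half_lens s x y (sqdist w x) (sqdist w y) z.
  by split => //; [exact: lt_x|exact: lt_y].
exists (sqdist w x), (sqdist w y); split => //.
- exact: lt_le_trans (lt_x _ _ awp wp2) px.
- exact: lt_le_trans (lt_y _ _ awp wp2) py.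
(* The segment from [z] to a lens point outside [S] would meet the frontier inside the convex
   lens. *)
move=> q hq; apply: contrapT => nSq.
have [l Il fl] := segment_meets_frontier clS Sz nSq.
have [l1 l2 l3] := half_lens_lerp hz hq Il.
by have [] := away _ fl l3; rewrite leNgt ?l1 ?l2.
Qed.

(** * Two pairs of discs *)

(** Each distance bound excludes the part of the base line beyond, and including, the opposite
    endpoint. In particular hinge vertices are excluded. *)
Lemma base_point {R : realType} (x y p : plane R) : x <> y ->
  cross x y p = 0 -> sqdist p x < sqdist x y -> sqdist p y < sqdist x y ->
  exists2 l, 0 < l < 1 & p = lerp x y l.
Proof.
move=> xy c0 hx hy; have D0 := sqdist_gt0 xy.
have hl := along_cross_sqdist_l x y p; have hr := along_cross_sqdist_r x y p.
set D := sqdist x y in D0 hx hy hl hr *; set a := along x y p in hl hr.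
rewrite c0 expr0n addr0 in hl; rewrite c0 expr0n addr0 in hr.
have aD : a < D by nra.
have a0 : 0 < a by nra.
exists (a / D); first by rewrite divr_gt0 //= ltr_pdivrMr // mul1r.
apply: (along_cross_inj xy); last by rewrite cross_base.
by rewrite along_base divfK // gt_eqF.
Qed.

Definition four_discs {R : realType} (x y u v : plane R) (r1 r2 r3 r4 : R) : set (plane R) :=
  [set q | [/\ sqdist q x < r1, sqdist q y < r2, sqdist q u < r3 & sqdist q v < r4]].

Lemma four_discsC {R : realType} (x y u v : plane R) (r1 r2 r3 r4 : R) (q : plane R) :
  four_discs x y u v r1 r2 r3 r4 q -> four_discs u v x y r3 r4 r1 r2 q.
Proof. by case. Qed.

Lemma four_discs_lerp {R : realType} (x y u v a b : plane R) (r1 r2 r3 r4 l : R) :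
  four_discs x y u v r1 r2 r3 r4 a -> four_discs x y u v r1 r2 r3 r4 b -> I01 l ->
  four_discs x y u v r1 r2 r3 r4 (lerp a b l).
Proof.
by move=> [a1 a2 a3 a4] [b1 b2 b3 b4] /andP[l0 l1]; split; exact: sqdist_lerp_lt.
Qed.

Lemma four_discs_contract {R : realType} (x y u v x' y' u' v' q' : plane R) (r1 r2 r3 r4 : R) :
  sqdist x y = sqdist x' y' -> sqdist u v = sqdist u' v' ->
  sqdist x u <= sqdist x' u' -> sqdist x v <= sqdist x' v' ->
  sqdist y u <= sqdist y' u' -> sqdist y v <= sqdist y' v' ->
  four_discs x' y' u' v' r1 r2 r3 r4 q' -> exists q, four_discs x y u v r1 r2 r3 r4 q.
Proof.
move=> xy uv xu xv yu yv [q1 q2 q3 q4].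
pose pick T (a b c d : T) (i : 'I_4) :=
  match val i with 0%N => a | 1%N => b | 2%N => c | _ => d end.
have [i j|i|q hq] := @contracted_discs_meet R 3 (pick _ x y u v) (pick _ x' y' u' v')
    (pick _ r1 r2 r3 r4) q'.
- case: i j => [[|[|[|[|i]]]] hi] [[|[|[|[|j]]]] hj] //; rewrite /pick /=;
    do ?[by rewrite /sqdist !subrr]; do ?[by rewrite ?xy ?uv];
    by rewrite sqdistC [leRHS]sqdistC ?xy ?uv.
- by case: i => [[|[|[|[|i]]]] hi].
exists q; split; [exact: (hq (@Ordinal 4 0 isT))|exact: (hq (@Ordinal 4 1 isT))|
  exact: (hq (@Ordinal 4 2 isT))|exact: (hq (@Ordinal 4 3 isT))].
Qed.

Lemma affine_pos_near {R : realType} (a b : R) : 0 < a \/ 0 <= a /\ 0 < b ->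
  exists2 e, 0 < e & forall l, 0 < l -> l < e -> l < 1 -> 0 < (1 - l) * a + l * b.
Proof.
case=> [a0|[a0 b0]]; last first.
  exists 1 => // l l0 l1 _; apply: ltr_wpDl; last exact: mulr_gt0.
  by rewrite mulr_ge0 // subr_ge0 ltW.
have s0 : 0 < a + `|b| by rewrite ltr_pwDl.
(* As [- |b| <= b], the combination is at least [a - l * (a + |b|)], which is positive below this
   threshold. *)
exists (a / (a + `|b|)); first exact: divr_gt0.
move=> l l0; rewrite ltr_pdivlMr // => h _.
have hb : - `|b| <= b by rewrite lerNl -normrN ler_norm.
nra.
Qed.

(** A small step from [p] towards [a] makes the disc inequalities strict by convexity. Each side
    condition survives if it is already strict at [p], or becomes strict if it is strict at [a]. *)
Lemma half_lenses_meet_near {R : realType} (x y u v p a : plane R) (s s' r1 r2 r3 r4 : R) :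
  sqdist p x <= r1 -> sqdist p y <= r2 -> sqdist p u <= r3 -> sqdist p v <= r4 ->
  four_discs x y u v r1 r2 r3 r4 a ->
  0 < s * cross x y p \/ 0 <= s * cross x y p /\ 0 < s * cross x y a ->
  0 < s' * cross u v p \/ 0 <= s' * cross u v p /\ 0 < s' * cross u v a ->
  half_lens s x y r1 r2 `&` half_lens s' u v r3 r4 !=set0.
Proof.
move=> p1 p2 p3 p4 [a1 a2 a3 a4] /affine_pos_near[e e0 he] /affine_pos_near[e' e'0 he'].
(* Halving the minimum keeps [l] strictly below both thresholds, and [1 / 2] keeps it below 1. *)
pose l := Num.min (1 / 2) (Num.min e e' / 2).
have m0 : 0 < Num.min e e' by rewrite lt_min e0.
have l0 : 0 < l by rewrite lt_min; apply/andP; split; lra.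
have l12 : l <= 1 / 2 by rewrite ge_min lexx.
have lm : l <= Num.min e e' / 2 by rewrite ge_min lexx orbT.
have me : Num.min e e' <= e by rewrite ge_min lexx.
have me' : Num.min e e' <= e' by rewrite ge_min lexx orbT.
have disc c r : sqdist p c <= r -> sqdist a c < r -> sqdist (lerp p a l) c < r.
  move=> pc ac; rewrite sqdist_lerp.
  have l1 : 0 <= 1 - l by lra.
  have := mulr_ge0 (mulr_ge0 (ltW l0) l1) (sqdist_ge0 p a); nra.
exists (lerp p a l); split; split; try exact: disc.
- by rewrite cross_lerp mulrDr !(mulrCA _ (1 - l)) !(mulrCA _ l); apply: he; lra.
- by rewrite cross_lerp mulrDr !(mulrCA _ (1 - l)) !(mulrCA _ l); apply: he'; lra.
Qed.

Lemma continuous_sqdist {R : realType} {T : topologicalType} (f g : T -> plane R) :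
  continuous f -> continuous g -> continuous (fun t => sqdist (f t) (g t)).
Proof.
move=> cf cg.
have c1 (h : T -> plane R) : continuous h -> continuous (fun t => (h t).1).
  by move=> ch t; apply: continuous_comp; [exact: ch|exact: cvg_fst].
have c2 (h : T -> plane R) : continuous h -> continuous (fun t => (h t).2).
  by move=> ch t; apply: continuous_comp; [exact: ch|exact: cvg_snd].
by apply: continuous_addr; apply: continuous_mulr; apply: continuous_subr; auto.
Qed.

Lemma continuous_cross3 {R : realType} {T : topologicalType} (f g h : T -> plane R) :
  continuous f -> continuous g -> continuous h ->
  continuous (fun t => cross (f t) (g t) (h t)).
Proof.
move=> cf cg ch.
have c1 (k : T -> plane R) : continuous k -> continuous (fun t => (k t).1).
  by move=> ck t; apply: continuous_comp; [exact: ck|exact: cvg_fst].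
have c2 (k : T -> plane R) : continuous k -> continuous (fun t => (k t).2).
  by move=> ck t; apply: continuous_comp; [exact: ck|exact: cvg_snd].
by apply: continuous_subr; apply: continuous_mulr; apply: continuous_subr; auto.
Qed.

Lemma near_lt_continuous {R : realType} {T : topologicalType} (f : T -> R) (t : T) (r : R) :
  continuous f -> f t < r -> \forall t' \near t, f t' < r.
Proof. by move=> cf; exact: (cvgr_lt _ (cf t)). Qed.

Lemma near_gt_continuous {R : realType} {T : topologicalType} (f : T -> R) (t : T) (r : R) :
  continuous f -> r < f t -> \forall t' \near t, r < f t'.
Proof. by move=> cf; exact: (cvgr_gt _ (cf t)). Qed.

Lemma continuous_rise {R : realType} (x y p : plane R) : continuous (rise x y p).
Proof.
have ck (k : R) : continuous (fun _ : R => k) by exact: cst_continuous.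
have ci : continuous (fun l : R => l) by move=> ?; exact: cvg_id.
apply: continuous_pairing.
  by apply: continuous_subr; [|apply: continuous_mulr].
by apply: continuous_addr; [|apply: continuous_mulr].
Qed.

(** The discs are open, so there is room to leave the base line; this supplies the strict sign that
    [half_lenses_meet_near] asks of [a]. *)
Lemma four_discs_rise {R : realType} (x y u v a : plane R) (s r1 r2 r3 r4 : R) :
  x <> y -> s ^+ 2 = 1 -> four_discs x y u v r1 r2 r3 r4 a -> 0 <= s * cross x y a ->
  exists2 a', four_discs x y u v r1 r2 r3 r4 a' & 0 < s * cross x y a'.
Proof.
move=> xy s1 [a1 a2 a3 a4] ca; have D0 := sqdist_gt0 xy.
have cs : continuous (fun t : R => rise x y a (s * t)).
  move=> t; apply: (@continuous_comp _ _ _ (fun t => s * t) (rise x y a)).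
    by apply: continuous_mulr; [exact: cst_continuous|move=> ?; exact: cvg_id].
  exact: continuous_rise.
have c0 (c : plane R) : continuous (fun _ : R => c) by exact: cst_continuous.
have s0 : rise x y a (s * 0) = a.
  by rewrite mulr0 /rise !mul0r subr0 addr0 -surjective_pairing.
have nd c r : sqdist a c < r -> \forall t \near (0 : R), sqdist (rise x y a (s * t)) c < r.
  move=> h; apply: (near_lt_continuous (f := fun t => sqdist (rise x y a (s * t)) c)).
    exact: continuous_sqdist.
  by rewrite s0.
have : \forall t \near (0 : R)^'+, four_discs x y u v r1 r2 r3 r4 (rise x y a (s * t)).
  have n1 := nd _ _ a1; have n2 := nd _ _ a2; have n3 := nd _ _ a3; have n4 := nd _ _ a4.
  by near=> t; split; near: t; apply: cvg_within.
move=> nr; have [t [ht t0]] : exists t : R,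
    four_discs x y u v r1 r2 r3 r4 (rise x y a (s * t)) /\ 0 < t.
  apply: (@filter_ex _ (0 : R)^'+); apply: filterI => //; exact: nbhs_right_gt.
exists (rise x y a (s * t)) => //.
rewrite cross_rise mulrDr !mulrA -expr2 s1 mul1r.
by have := mulr_gt0 t0 D0; lra.
Unshelve. all: end_near. Qed.

(** * Bars moving apart *)

(** What a single pair of bars retains of the motion. Time runs over all of [R], so that continuity
    involves no subspace topology; the metric conditions concern [I01] only. *)
Definition expanding_bars {R : realType} (x y u v : R -> plane R) : Prop :=
  [/\ continuous x, continuous y, continuous u, continuous v &
  forall t t', I01 t -> I01 t' -> t <= t' ->
    [/\ sqdist (x t) (y t) = sqdist (x t') (y t'),
        sqdist (u t) (v t) = sqdist (u t') (v t') &
     forall a b, I01 a -> I01 b ->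
       sqdist (lerp (x t) (y t) a) (lerp (u t) (v t) b) <=
       sqdist (lerp (x t') (y t') a) (lerp (u t') (v t') b)]].

Lemma expanding_barsC {R : realType} (x y u v : R -> plane R) :
  expanding_bars x y u v -> expanding_bars u v x y.
Proof.
move=> [cx cy cu cv h]; split => // t t' It It' tt'; have [h1 h2 h3] := h _ _ It It' tt'.
by split => // a b Ia Ib; rewrite sqdistC [leRHS]sqdistC; exact: h3.
Qed.

Lemma expanding_bars_discs {R : realType} (x y u v : R -> plane R) (r1 r2 r3 r4 t t' : R) q' :
  expanding_bars x y u v -> I01 t -> I01 t' -> t <= t' ->
  four_discs (x t') (y t') (u t') (v t') r1 r2 r3 r4 q' ->
  exists q, four_discs (x t) (y t) (u t) (v t) r1 r2 r3 r4 q.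
Proof.
move=> [_ _ _ _ h] It It' tt'; have [h1 h2 h3] := h _ _ It It' tt'.
apply: four_discs_contract => //.
- by have := h3 0 0 I01_0 I01_0; rewrite !lerp0.
- by have := h3 0 1 I01_0 I01_1; rewrite !lerp0 !lerp1.
- by have := h3 1 0 I01_1 I01_0; rewrite !lerp0 !lerp1.
- by have := h3 1 1 I01_1 I01_1; rewrite !lerp1.
Qed.

Lemma near_four_discs {R : realType} (x y u v : R -> plane R) (r1 r2 r3 r4 t : R) q :
  continuous x -> continuous y -> continuous u -> continuous v ->
  four_discs (x t) (y t) (u t) (v t) r1 r2 r3 r4 q ->
  \forall t' \near t, four_discs (x t') (y t') (u t') (v t') r1 r2 r3 r4 q.
Proof.
move=> cx cy cu cv [q1 q2 q3 q4].
have nd (c : R -> plane R) r : continuous c -> sqdist q (c t) < r ->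
    \forall t' \near t, sqdist q (c t') < r.
  move=> cc; apply: (near_lt_continuous (f := fun t => sqdist q (c t))).
  by apply: continuous_sqdist => //; exact: cst_continuous.
have n1 := nd _ _ cx q1; have n2 := nd _ _ cy q2.
have n3 := nd _ _ cu q3; have n4 := nd _ _ cv q4.
by near=> t'; split; near: t'.
Unshelve. all: end_near. Qed.

Lemma sqdist_base_l {R : realType} (x y : plane R) (l : R) :
  sqdist (lerp x y l) x = l ^+ 2 * sqdist x y.
Proof. by rewrite /sqdist /lerp /=; ring. Qed.

Lemma sqdist_base_r {R : realType} (x y : plane R) (l : R) :
  sqdist (lerp x y l) y = (1 - l) ^+ 2 * sqdist x y.
Proof. by rewrite /sqdist /lerp /=; ring. Qed.

(* When the common point [w] of the discs lies below the base at time [t], it still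
   does so shortly afterwards, while the discs then also meet above the base; by
   convexity they meet on the bar, and a meeting point on a bar survives going
   back in time. *)
Lemma discs_meet_above {R : realType} (x y u v : R -> plane R) (s r1 r2 r3 r4 t : R) w :
  expanding_bars x y u v -> I01 t -> x t <> y t ->
  r1 < sqdist (x t) (y t) -> r2 < sqdist (x t) (y t) ->
  four_discs (x t) (y t) (u t) (v t) r1 r2 r3 r4 w ->
  (forall e, 0 < e -> exists t' z, [/\ I01 t', t <= t' < t + e,
     four_discs (x t') (y t') (u t') (v t') r1 r2 r3 r4 z &
     0 < s * cross (x t') (y t') z]) ->
  exists2 a, four_discs (x t) (y t) (u t) (v t) r1 r2 r3 r4 a &
    0 <= s * cross (x t) (y t) a.
Proof.
move=> mot It xy r1D r2D hw ev; have [cx cy cu cv h] := mot.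
have [c0|c0] := leP 0 (s * cross (x t) (y t) w); first by exists w.
have n1 := near_four_discs cx cy cu cv hw.
have n2 : \forall t' \near t, s * cross (x t') (y t') w < 0.
  apply: (near_lt_continuous (f := fun t => s * cross (x t) (y t) w)) => //.
  apply: continuous_mulr; first exact: cst_continuous.
  by apply: continuous_cross3 => //; exact: cst_continuous.
have : \forall t' \near t, four_discs (x t') (y t') (u t') (v t') r1 r2 r3 r4 w /\
    s * cross (x t') (y t') w < 0 by exact: filterI.
move=> /nbhs_ballP[e e0 be].
have [t' [z [It' /andP[tt' t'e] hz cz]]] := ev e e0.
have [hw' cw'] : four_discs (x t') (y t') (u t') (v t') r1 r2 r3 r4 w /\
    s * cross (x t') (y t') w < 0.
  by apply: be; rewrite -ball_normE /= distrC ger0_norm ?subr_ge0 // ltrBlDl.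
have [eD _ hAB] := h _ _ It It' tt'.
set fw := s * cross (x t') (y t') w in cw'; set fz := s * cross (x t') (y t') z in cz.
have d0 : 0 < fz - fw by lra.
(* The zero of the affine function [s * cross] along the segment from [w] to [z]. *)
pose l := - fw / (fz - fw).
have Il : I01 l.
  apply/andP; split; first by rewrite divr_ge0 //; lra.
  by rewrite ler_pdivrMr //; lra.
have [q1 q2 q3 q4] := four_discs_lerp hw' hz Il; set q := lerp w z l in q1 q2 q3 q4.
have cq : cross (x t') (y t') q = 0.
  have : s * cross (x t') (y t') q = 0.
    rewrite cross_lerp mulrDr !(mulrCA s) -/fw -/fz /l; field; exact: lt0r_neq0.
  move=> /eqP; rewrite mulf_eq0 => /orP[/eqP s0|/eqP //].
  by move: cz; rewrite /fz s0 mul0r ltxx.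
have xy' : x t' <> y t'.
  move=> e'; have := sqdist_gt0 xy; rewrite eD e' /sqdist !subrr expr0n addr0 /= ltxx //.
have [||m /andP[m0 m1] qE] := base_point xy' cq.
- by apply: lt_trans q1 _; rewrite -eD.
- by apply: lt_trans q2 _; rewrite -eD.
have Im : I01 m by apply/andP; split; exact: ltW.
(* The same material point of the bar at the earlier time: its distances to its own endpoints are
   unchanged, and those to the other bar were no larger. *)
exists (lerp (x t) (y t) m); last by rewrite cross_base mulr0.
split.
- by move: q1; rewrite qE !sqdist_base_l eD.
- by move: q2; rewrite qE !sqdist_base_r eD.
- have := hAB m 0 Im I01_0; rewrite !lerp0 -qE => /le_lt_trans; exact.
- have := hAB m 1 Im I01_1; rewrite !lerp1 -qE => /le_lt_trans; exact.
Qed.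

Definition closed_half_lens {R : realType} (s : R) (x y : plane R) (r1 r2 : R) : set (plane R) :=
  [set q | [/\ sqdist q x <= r1, sqdist q y <= r2 & 0 <= s * cross x y q]].

Lemma half_lens_closed {R : realType} (s : R) (x y : plane R) (r1 r2 : R) :
  half_lens s x y r1 r2 `<=` closed_half_lens s x y r1 r2.
Proof. by move=> q [h1 h2 h3]; split; exact: ltW. Qed.

(** [1 + r] stands in for the square root of [r]; a crude box is enough for compactness. *)
Lemma sqr_le_box {R : realType} (d r : R) :
  0 <= r -> d ^+ 2 <= r -> - (1 + r) <= d <= 1 + r.
Proof.
move=> r0 dr; rewrite -ler_norml -ler_sqr ?nnegrE ?addr_ge0 // real_normK ?num_real //.
nra.
Qed.

(** With non-strict inequalities, the pairs of a time and a common point form a compact set, whose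
    projection to time is compact. *)
Lemma closed_meeting_times {R : realType} (x y u v : R -> plane R) (s s' r1 r2 r3 r4 : R) :
  continuous x -> continuous y -> continuous u -> continuous v ->
  closed [set t | I01 t /\
    closed_half_lens s (x t) (y t) r1 r2 `&` closed_half_lens s' (u t) (v t) r3 r4 !=set0].
Proof.
move=> cx cy cu cv.
(* [e] is the position of the meeting point relative to [x t]: it stays in a fixed box *)
pose pt (w : R * plane R) : plane R := ((x w.1).1 + w.2.1, (x w.1).2 + w.2.2).
pose Box : set (R * plane R) := `[0, 1] `*` (`[- (1 + r1), 1 + r1] `*` `[- (1 + r1), 1 + r1]).
have cBox : compact Box by do 2?[apply: compact_setX]; exact: segment_compact.
pose K := [set w : R * plane R | [/\ Box w,
   sqdist (pt w) (x w.1) <= r1 /\ sqdist (pt w) (y w.1) <= r2,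
   sqdist (pt w) (u w.1) <= r3 /\ sqdist (pt w) (v w.1) <= r4,
   0 <= s * cross (x w.1) (y w.1) (pt w) & 0 <= s' * cross (u w.1) (v w.1) (pt w)]].
have c1 : continuous (fun w : R * plane R => w.1) by move=> w; exact: cvg_fst.
have cc (c : R -> plane R) : continuous c -> continuous (fun w : R * plane R => c w.1).
  by move=> kc w; apply: continuous_comp; [exact: c1|exact: kc].
have cpt : continuous pt.
  have cf : continuous (fun p : plane R => p.1) by move=> w; exact: cvg_fst.
  have cs : continuous (fun p : plane R => p.2) by move=> w; exact: cvg_snd.
  have c2 : continuous (fun w : R * plane R => w.2) by move=> w; exact: cvg_snd.
  apply: continuous_pairing; apply: continuous_addr => w.
  - by apply: continuous_comp; [exact: cc|exact: cf].
  - by apply: continuous_comp; [exact: c2|exact: cf].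
  - by apply: continuous_comp; [exact: cc|exact: cs].
  - by apply: continuous_comp; [exact: c2|exact: cs].
have cK : compact K.
  apply: (subclosed_compact _ cBox); last by move=> w [].
  have clB : closed Box.
    by apply: compact_closed => //; exact: norm_hausdorff.
  have cle (f : R * plane R -> R) r : continuous f -> closed [set w | f w <= r].
    move=> cf; apply: (@closed_comp _ _ f [set z | z <= r]); last exact: closed_le.
    by move=> w _; exact: cf.
  have cge (f : R * plane R -> R) r : continuous f -> closed [set w | r <= f w].
    move=> cf; apply: (@closed_comp _ _ f [set z | r <= z]); last exact: closed_ge.
    by move=> w _; exact: cf.
  have -> : K = Box `&` [set w | sqdist (pt w) (x w.1) <= r1] `&`
     [set w | sqdist (pt w) (y w.1) <= r2] `&` [set w | sqdist (pt w) (u w.1) <= r3] `&`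
     [set w | sqdist (pt w) (v w.1) <= r4] `&`
     [set w | 0 <= s * cross (x w.1) (y w.1) (pt w)] `&`
     [set w | 0 <= s' * cross (u w.1) (v w.1) (pt w)].
    by apply/seteqP; split=> w; [move=> [? [? ?] [? ?] ? ?]|move=> [[[[[[]]]]]]].
  have d (c : R -> plane R) r : continuous c -> closed [set w | sqdist (pt w) (c w.1) <= r].
    by move=> kc; apply: cle; apply: continuous_sqdist => //; exact: cc.
  have hp (c c' : R -> plane R) (k : R) : continuous c -> continuous c' ->
      closed [set w | 0 <= k * cross (c w.1) (c' w.1) (pt w)].
    move=> kc kc'; apply: cge; apply: continuous_mulr; first exact: cst_continuous.
    by apply: continuous_cross3 => //; exact: cc.
  apply: closedI; last exact: hp.
  apply: closedI; last exact: hp.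
  apply: closedI; last exact: d.
  apply: closedI; last exact: d.
  apply: closedI; last exact: d.
  by apply: closedI; [exact: clB|exact: d].
have -> : [set t | I01 t /\ closed_half_lens s (x t) (y t) r1 r2 `&`
    closed_half_lens s' (u t) (v t) r3 r4 !=set0] = fst @` K.
  apply/seteqP; split=> t /=.
    move=> [It [p [[p1 p2 p3] [p4 p5 p6]]]].
    have e : pt (t, (p.1 - (x t).1, p.2 - (x t).2)) = p.
      by rewrite /pt /= !subrKC -surjective_pairing.
    exists (t, (p.1 - (x t).1, p.2 - (x t).2)) => //.
    split; rewrite ?e //=; split; first by rewrite /= in_itv.
    have r0 : 0 <= r1 := le_trans (sqdist_ge0 _ _) p1.
    have [b1 b2] : (p.1 - (x t).1) ^+ 2 <= r1 /\ (p.2 - (x t).2) ^+ 2 <= r1.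
      by split; apply: le_trans p1; rewrite /sqdist ?lerDl ?lerDr sqr_ge0.
    by split; rewrite /= in_itv; exact: sqr_le_box.
  move=> [[t' e] [[/= Bt _] [k1 k2] [k3 k4] k5 k6] <-] /=; split; first by rewrite /= in_itv in Bt.
  by exists (pt (t', e)).
apply: compact_closed; first exact: norm_hausdorff.
apply: continuous_compact => //; exact: continuous_subspaceT.
Qed.

(* A limiting common point [p] off both base lines is pushed towards a common
   point [w] of the open discs; on one base line it is pushed towards a point
   given by [discs_meet_above]; on both, the bars cross at interior points, and by
   expansion they already did so at time 0. *)
Lemma half_lenses_meet_limit {R : realType} (x y u v : R -> plane R)
    (s s' r1 r2 r3 r4 t : R) :
  expanding_bars x y u v -> I01 t -> x t <> y t -> u t <> v t ->
  s ^+ 2 = 1 -> s' ^+ 2 = 1 ->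
  r1 < sqdist (x t) (y t) -> r2 < sqdist (x t) (y t) ->
  r3 < sqdist (u t) (v t) -> r4 < sqdist (u t) (v t) ->
  (forall a b : R, 0 < a < 1 -> 0 < b < 1 -> lerp (x 0) (y 0) a <> lerp (u 0) (v 0) b) ->
  closed_half_lens s (x t) (y t) r1 r2 `&` closed_half_lens s' (u t) (v t) r3 r4 !=set0 ->
  (forall e, 0 < e -> exists t', [/\ I01 t', t <= t' < t + e &
    half_lens s (x t') (y t') r1 r2 `&` half_lens s' (u t') (v t') r3 r4 !=set0]) ->
  half_lens s (x t) (y t) r1 r2 `&` half_lens s' (u t) (v t) r3 r4 !=set0.
Proof.
move=> mot It xy uv s1 s1' r1D r2D r3D r4D apart0 [p [[p1 p2 p3] [p4 p5 p6]]] ev.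
(* Kirszbraun, applied from a meeting time [t' >= t], shows that the open discs still meet at [t],
   where so far only the closed half-lenses do. *)
have [w hw] : exists w, four_discs (x t) (y t) (u t) (v t) r1 r2 r3 r4 w.
  have [t' [It' /andP[tt' _] [q [[q1 q2 _] [q3 q4 _]]]]] := ev 1 ltr01.
  by apply: (expanding_bars_discs mot It It' tt' (q' := q)).
have [a0|a0] := ltP 0 (s * cross (x t) (y t) p);
  have [b0|b0] := ltP 0 (s' * cross (u t) (v t) p).
- by apply: (half_lenses_meet_near p1 p2 p4 p5 hw); left.
- have [|a ha ca] := discs_meet_above (s := s') (expanding_barsC mot) It uv r3D r4D
    (four_discsC hw).
    move=> e e0; have [t' [It' tt' [z [[z1 z2 z3] [z4 z5 z6]]]]] := ev e e0.
    by exists t', z.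
  have [a' ha' ca'] := four_discs_rise uv s1' ha ca.
  by apply: (half_lenses_meet_near p1 p2 p4 p5 (four_discsC ha')); [left|right].
- have [|a ha ca] := discs_meet_above (s := s) mot It xy r1D r2D hw.
    move=> e e0; have [t' [It' tt' [z [[z1 z2 z3] [z4 z5 z6]]]]] := ev e e0.
    by exists t', z.
  have [a' ha' ca'] := four_discs_rise xy s1 ha ca.
  by apply: (half_lenses_meet_near p1 p2 p4 p5 ha'); [right|left].
have cr0 (k c : R) : k ^+ 2 = 1 -> 0 <= k * c -> k * c <= 0 -> c = 0.
  move=> k1 h1 h2; have /eqP : k * c = 0 by lra.
  rewrite mulf_eq0 => /orP[/eqP k0|/eqP //].
  by move: k1; rewrite k0 expr0n /= => /eqP; rewrite eq_sym oner_eq0.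
have [a ra pa] := base_point xy (cr0 _ _ s1 p3 a0) (le_lt_trans p1 r1D) (le_lt_trans p2 r2D).
have [b rb pb] := base_point uv (cr0 _ _ s1' p6 b0) (le_lt_trans p4 r3D) (le_lt_trans p5 r4D).
exfalso; have [_ _ _ _ h] := mot; have /andP[t0 _] := It.
have [_ _ hab] := h _ _ I01_0 It t0.
have I (l : R) : 0 < l < 1 -> I01 l by move=> /andP[l0 l1]; apply/andP; split; exact: ltW.
have := hab _ _ (I _ ra) (I _ rb); rewrite -pa -pb.
rewrite /(sqdist p p) !subrr expr0n addr0 leNgt => /negP; apply.
exact/sqdist_gt0/apart0.
Qed.

(** At the infimum [t] of the meeting times the closed half-lenses meet by closedness, hence the
    open ones by [half_lenses_meet_limit]. Meeting of open sets persists just before [t], so [t]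
    must be 0. *)
Lemma half_lenses_persist {R : realType} (x y u v : R -> plane R) (s s' r1 r2 r3 r4 t1 : R) :
  expanding_bars x y u v -> x 0 <> y 0 -> u 0 <> v 0 ->
  s ^+ 2 = 1 -> s' ^+ 2 = 1 ->
  r1 < sqdist (x 0) (y 0) -> r2 < sqdist (x 0) (y 0) ->
  r3 < sqdist (u 0) (v 0) -> r4 < sqdist (u 0) (v 0) ->
  (forall a b : R, 0 < a < 1 -> 0 < b < 1 -> lerp (x 0) (y 0) a <> lerp (u 0) (v 0) b) ->
  I01 t1 ->
  half_lens s (x t1) (y t1) r1 r2 `&` half_lens s' (u t1) (v t1) r3 r4 !=set0 ->
  half_lens s (x 0) (y 0) r1 r2 `&` half_lens s' (u 0) (v 0) r3 r4 !=set0.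
Proof.
move=> mot xy uv s1 s1' r1D r2D r3D r4D apart0 It1 meet1.
have [cx cy cu cv h] := mot.
pose Q := [set t | I01 t /\
  half_lens s (x t) (y t) r1 r2 `&` half_lens s' (u t) (v t) r3 r4 !=set0].
have Q1 : Q t1 by [].
have lbQ : lbound Q 0 by move=> t [/andP[]].
have hiQ : has_inf Q by split; [exists t1|exists 0].
set t := inf Q.
have ev e : 0 < e -> exists t', [/\ Q t', t <= t' & t' < t + e].
  move=> e0; have [t' Qt' lt'] := inf_adherent e0 hiQ.
  by exists t'; split => //; apply: ge_inf => //; exists 0.
have [It meet] : [set t | I01 t /\ closed_half_lens s (x t) (y t) r1 r2 `&`
    closed_half_lens s' (u t) (v t) r3 r4 !=set0] t.
  apply: closed_meeting_times => // B /nbhs_ballP[e e0 be].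
  have [t' [[It' [q [q1 q2]]] tt' t'e]] := ev e e0.
  exists t'; split.
    by split => //; exists q; split; exact: half_lens_closed.
  by apply: be; rewrite -ball_normE /= distrC ger0_norm ?subr_ge0 // ltrBlDl.
have /andP[t0 _] := It.
have [eD eD' _] := h _ _ I01_0 It t0.
have xyt : x t <> y t.
  by move=> e; have := sqdist_gt0 xy; rewrite eD e /sqdist !subrr expr0n addr0 ltxx.
have uvt : u t <> v t.
  by move=> e; have := sqdist_gt0 uv; rewrite eD' e /sqdist !subrr expr0n addr0 ltxx.
have Qt : half_lens s (x t) (y t) r1 r2 `&` half_lens s' (u t) (v t) r3 r4 !=set0.
  apply: half_lenses_meet_limit => //; rewrite -?eD -?eD' //.
  move=> e /ev[t' [[It' m'] tt' t'e]]; exists t'; split => //; exact/andP.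
move: t0; rewrite le_eqVlt => /orP[/eqP t0|t0]; first by move: Qt; rewrite -t0.
exfalso.
have [q [[q1 q2 q3] [q4 q5 q6]]] := Qt.
have n1 : \forall t' \near t, four_discs (x t') (y t') (u t') (v t') r1 r2 r3 r4 q.
  exact: near_four_discs.
have n2 : \forall t' \near t, 0 < s * cross (x t') (y t') q.
  apply: (near_gt_continuous (f := fun t => s * cross (x t) (y t) q)) => //.
  apply: continuous_mulr; first exact: cst_continuous.
  by apply: continuous_cross3 => //; exact: cst_continuous.
have n3 : \forall t' \near t, 0 < s' * cross (u t') (v t') q.
  apply: (near_gt_continuous (f := fun t => s' * cross (u t) (v t) q)) => //.
  apply: continuous_mulr; first exact: cst_continuous.
  by apply: continuous_cross3 => //; exact: cst_continuous.
(* Keeps the earlier time [t - e / 2] inside [I01]. *)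
have n4 : \forall t' \near t, 0 < t' by exact: lt_nbhsr.
have /nbhs_ballP[e e0 be] : \forall t' \near t, 0 < t' /\
    half_lens s (x t') (y t') r1 r2 q /\ half_lens s' (u t') (v t') r3 r4 q.
  near=> t'; have [m1 m2 m3 m4] : four_discs (x t') (y t') (u t') (v t') r1 r2 r3 r4 q.
    by near: t'.
  by split; [near: t'|split; split => //; near: t'].
have e0' : 0 < e := e0.
have [t'0 [m1 m2]] : 0 < t - e / 2 /\ half_lens s (x (t - e / 2)) (y (t - e / 2)) r1 r2 q /\
    half_lens s' (u (t - e / 2)) (v (t - e / 2)) r3 r4 q.
  apply: be; rewrite -ball_normE /= opprB addrC subrK ger0_norm; last by rewrite divr_ge0 // ltW.
  by rewrite ltr_pdivrMr // ltr_pMr // ltr1n.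
have : t <= t - e / 2.
  apply: ge_inf; first by exists 0.
  split; last by exists q.
  have /andP[_ t1'] := It; apply/andP; split; first exact: ltW.
  by rewrite (le_trans _ t1') // gerBl divr_ge0 // ltW.
by rewrite leNgt gtrBl divr_gt0.
Unshelve. all: end_near. Qed.

(** * Rigid motions and overlaps *)

Lemma rigid_motion_inverse {R : realType} (f : plane R -> plane R) :
  rigid_motion f -> exists f', [/\ rigid_motion f', cancel f f' & cancel f' f].
Proof.
move=> [c [s [b1 [b2 [cs fE]]]]].
exists (fun q => (c * q.1 - (- s) * q.2 + (- c * b1 - s * b2),
                  (- s) * q.1 + c * q.2 + (s * b1 - c * b2))); split.
- by exists c, (- s), (- c * b1 - s * b2), (s * b1 - c * b2); split => //; rewrite sqrrN.
- move=> [p1 p2]; rewrite fE /=; congr (_, _).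
    by transitivity ((c ^+ 2 + s ^+ 2) * p1); [ring|rewrite cs mul1r].
  by transitivity ((c ^+ 2 + s ^+ 2) * p2); [ring|rewrite cs mul1r].
- move=> [p1 p2]; rewrite fE /=; congr (_, _).
    transitivity ((c ^+ 2 + s ^+ 2) * p1 + (1 - (c ^+ 2 + s ^+ 2)) * b1); first by ring.
    by rewrite cs; ring.
  transitivity ((c ^+ 2 + s ^+ 2) * p2 + (1 - (c ^+ 2 + s ^+ 2)) * b2); first by ring.
  by rewrite cs; ring.
Qed.

Lemma sqdist_rigid {R : realType} (f : plane R -> plane R) (p q : plane R) :
  rigid_motion f -> sqdist (f p) (f q) = sqdist p q.
Proof.
move=> [c [s [b1 [b2 [cs fE]]]]]; rewrite !fE /sqdist /=.
by rewrite -[RHS]mul1r -cs; ring.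
Qed.

(** The determinant is 1, not just 1 in absolute value: sides of the base are preserved, so one sign
    serves a half-lens at all times. *)
Lemma cross_rigid {R : realType} (f : plane R -> plane R) (x y q : plane R) :
  rigid_motion f -> cross (f x) (f y) (f q) = cross x y q.
Proof.
move=> [c [s [b1 [b2 [cs fE]]]]]; rewrite !fE /cross /=.
by rewrite -[RHS]mul1r -cs; ring.
Qed.

Lemma half_lens_rigid {R : realType} (f : plane R -> plane R) (s r1 r2 : R) (x y q : plane R) :
  rigid_motion f -> half_lens s x y r1 r2 q -> half_lens s (f x) (f y) r1 r2 (f q).
Proof. by move=> rf [h1 h2 h3]; split; rewrite ?sqdist_rigid ?cross_rigid. Qed.

Lemma rigid_motion_continuous {R : realType} (f : plane R -> plane R) :
  rigid_motion f -> continuous f.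
Proof.
move=> [c [s [b1 [b2 [cs fE]]]]]; rewrite (funext fE).
have c1 : continuous (fun q : plane R => q.1) by move=> q; exact: cvg_fst.
have c2 : continuous (fun q : plane R => q.2) by move=> q; exact: cvg_snd.
have ck (k : R) : continuous (fun _ : plane R => k) by exact: cst_continuous.
apply: continuous_pairing; apply: continuous_addr => //.
  by apply: continuous_subr; apply: continuous_mulr.
by apply: continuous_addr; apply: continuous_mulr.
Qed.

Lemma interior_rigid {R : realType} (f : plane R -> plane R) (A : set (plane R)) (a : plane R) :
  rigid_motion f -> interior (f @` A) (f a) <-> interior A a.
Proof.
move=> rf; have [f' [rf' fK f'K]] := rigid_motion_inverse rf.
split => h.
  have : nbhs a (f @^-1` (f @` A)) by exact: (rigid_motion_continuous rf).
  by apply: filterS => b [b' Ab' /(can_inj fK) <-].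
have : nbhs (f a) (f' @^-1` A) by apply: (rigid_motion_continuous rf'); rewrite fK.
by apply: filterS => b Ab; exists (f' b).
Qed.

(** Each set is the closure of its interior, so a point of one inside the open interior of the other
    can be moved into its own interior. *)
Lemma rigid_overlap_interior {R : realType} (f g : plane R -> plane R) (A B : set (plane R)) :
  rigid_motion f -> rigid_motion g -> A = closure (interior A) -> B = closure (interior B) ->
  overlap (f @` A) (g @` B) -> interior (f @` A) `&` interior (g @` B) !=set0.
Proof.
have main (f' g' : plane R -> plane R) (A' B' : set (plane R)) p : rigid_motion f' ->
    A' = closure (interior A') -> (f' @` A') p -> interior (g' @` B') p ->
    interior (f' @` A') `&` interior (g' @` B') !=set0.
  move=> rf AE [a Aa <-] gB; rewrite AE in Aa.
  have U : nbhs a (f' @^-1` interior (g' @` B')).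
    apply: (rigid_motion_continuous rf).
    by apply: open_nbhs_nbhs; split => //; exact: open_interior.
  have [b [Ab Bb]] := Aa _ U; exists (f' b); split => //.
  exact/interior_rigid.
move=> rf rg AE BE [p [[h1 h2]|[h1 h2]]]; first exact: main rf AE h1 h2.
by rewrite setIC; exact: main rg BE h1 h2.
Qed.

Lemma near_off_line {R : realType} (x y a : plane R) (V : set (plane R)) :
  x <> y -> open V -> V a -> exists2 b, V b & cross x y b <> 0.
Proof.
move=> xy oV Va; have [c0|c0] := pselect (cross x y a = 0); last by exists a.
have s0 : rise x y a 0 = a by rewrite /rise !mul0r subr0 addr0 -surjective_pairing.
have : \forall t \near (0 : R), V (rise x y a t).
  by apply: continuous_rise; rewrite s0; exact: open_nbhs_nbhs.
move=> nV; have nV' : \forall t \near (0 : R)^'+, V (rise x y a t).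
  by near=> t; near: t; apply: cvg_within.
have [t [Vt t0]] : exists t : R, V (rise x y a t) /\ 0 < t.
  apply: (@filter_ex _ (0 : R)^'+); apply: filterI => //; exact: nbhs_right_gt.
exists (rise x y a t) => //; rewrite cross_rise c0 add0r.
by apply/eqP; rewrite gt_eqF // mulr_gt0 // sqdist_gt0.
Unshelve. all: end_near. Qed.

(** Half-lenses are only available around points off the base line, so a common interior point is
    first moved off both lines. *)
Lemma off_lines {R : realType} (x y u v a : plane R) (V : set (plane R)) :
  x <> y -> u <> v -> open V -> V a ->
  exists2 b, V b & cross x y b <> 0 /\ cross u v b <> 0.
Proof.
move=> xy uv oV Va; have [b Vb cb] := near_off_line xy oV Va.
have oV' : open (V `&` [set q | cross x y q != 0]).
  apply: openI => //; apply: (@open_comp _ _ (cross x y) [set z | z != 0]).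
    by move=> q _; exact: continuous_cross.
  exact: open_neq.
have [|c [Vc /eqP cc] cc'] := near_off_line uv oV' (a := b); last by exists c.
by split => //; exact/eqP.
Qed.

Lemma open_half_lens {R : realType} (s : R) (x y : plane R) (r1 r2 : R) :
  open (half_lens s x y r1 r2).
Proof.
have -> : half_lens s x y r1 r2 = [set q | sqdist q x < r1] `&` [set q | sqdist q y < r2] `&`
    [set q | 0 < s * cross x y q].
  by apply/seteqP; split=> q; [move=> []|move=> [[]]].
have ci : continuous (fun q : plane R => q) by move=> ?; exact: cvg_id.
have cd c : continuous (fun q : plane R => sqdist q c).
  by apply: continuous_sqdist => //; exact: cst_continuous.
apply: openI; first apply: openI.
- by apply: (@open_comp _ _ (sqdist^~ x) [set z | z < r1]);
    [move=> q _; exact: cd|exact: open_lt].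
- by apply: (@open_comp _ _ (sqdist^~ y) [set z | z < r2]);
    [move=> q _; exact: cd|exact: open_lt].
- apply: (@open_comp _ _ (fun q => s * cross x y q) [set z | 0 < z]); last exact: open_gt.
  move=> q _; apply: continuous_mulr; first exact: cst_continuous.
  exact: continuous_cross.
Qed.

Lemma sign_pos {R : realType} (c : R) : c <> 0 -> exists2 s : R, s ^+ 2 = 1 & 0 < s * c.
Proof.
move=> /eqP c0; case: (ltgtP c 0) => [h|h|h]; last by rewrite h eqxx in c0.
  by exists (- 1); [rewrite sqrrN expr1n|rewrite mulN1r oppr_gt0].
by exists 1; [rewrite expr1n|rewrite mul1r].
Qed.

Theorem mainTheorem7 (R : realType) (n : nat) (closed : bool)
  (C : R -> nat -> plane R) (S : nat -> set (plane R)) :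
  expansive_motion n closed C ->
  (forall k l, (k < n)%N -> (l < n)%N -> k <> l ->
     open_segment (C 0 k) (C 0 k.+1) `&` open_segment (C 0 l) (C 0 l.+1)
       = set0) ->
  (forall k, (k < n)%N -> slender_adornment (S k) (C 0 k) (C 0 k.+1)) ->
  (forall k l, (k < n)%N -> (l < n)%N -> k <> l -> ~ overlap (S k) (S l)) ->
  forall t, I01 t ->
  forall k l, (k < n)%N -> (l < n)%N -> k <> l ->
  forall f g : plane R -> plane R,
    rigid_motion f -> f (C 0 k) = C t k -> f (C 0 k.+1) = C t k.+1 ->
    rigid_motion g -> g (C 0 l) = C t l -> g (C 0 l.+1) = C t l.+1 ->
    ~ overlap (f @` S k) (g @` S l).
Proof.
move=> [contC [_ [barC expC]]] apart slender nonover t It k l kn ln kl f g rf fx fy rg gu gv ov.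
apply: (nonover _ _ kn ln kl).
have sk := slender _ kn; have sl := slender _ ln.
have [[_ [_ [Ek [xy _]]]] _] := sk; have [[_ [_ [El [uv _]]]] _] := sl.
have [z0 Wz0] := rigid_overlap_interior rf rg Ek El ov.
have neq (h : plane R -> plane R) (p q : plane R) : rigid_motion h -> p <> q -> h p <> h q.
  by move=> rh pq e; apply: pq; have [h' [_ hK _]] := rigid_motion_inverse rh; exact: (can_inj hK).
have oW : open (interior (f @` S k) `&` interior (g @` S l)).
  by apply: openI; exact: open_interior.
have [z [Wf Wg] [cf cg]] := off_lines (neq _ _ _ rf xy) (neq _ _ _ rg uv) oW Wz0.
have [a Sa az] := interior_subset Wf; have [b Sb bz] := interior_subset Wg.
rewrite -az cross_rigid // in cf; rewrite -bz cross_rigid // in cg.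
move: Wf; rewrite -az => /interior_rigid - /(_ rf) ia.
move: Wg; rewrite -bz => /interior_rigid - /(_ rg) ib.
have [s s1 ca] := sign_pos cf; have [s' s1' cb] := sign_pos cg.
(* The half-lenses are built at time 0, around the preimages [a] and [b] of [z], so that going back
   in time ends inside [S k] and [S l] themselves. *)
have [r1 [r2 [r1D r2D ha subA]]] := slender_half_lens sk s1 ia ca.
have [r3 [r4 [r3D r4D hb subB]]] := slender_half_lens sl s1' ib cb.
pose V i := (fun t => C t i) \o clamp01.
have V0 i : V i 0 = C 0 i by rewrite /V /= clamp01_id //; exact: I01_0.
have mot : expanding_bars (V k) (V k.+1) (V l) (V l.+1).
  have cV i : (i <= n)%N -> continuous (V i).
    by move=> /contC; exact: continuous_clamp.
  split; try by apply: cV => //; exact: ltnW.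
  move=> t1 t2 It1 It2 t12; rewrite /V /= !clamp01_id //; split.
  - by apply: dist_sqdist; rewrite !barC.
  - by apply: dist_sqdist; rewrite !barC.
  - by move=> a' b' Ia' Ib'; rewrite -ler_dist; exact: expC.
have [] := half_lenses_persist (s := s) (s' := s') (r1 := r1) (r2 := r2) (r3 := r3) (r4 := r4)
   mot _ _ s1 s1' _ _ _ _ _ It; rewrite ?V0 //.
- move=> a' b' ra rb e.
  have : (open_segment (C 0 k) (C 0 k.+1) `&` open_segment (C 0 l) (C 0 l.+1))
      (lerp (C 0 k) (C 0 k.+1) a').
    by split; [exists a'|rewrite e; exists b'].
  by rewrite apart.
- exists z; rewrite /V /= clamp01_id // -fx -fy -gu -gv; split.
    by rewrite -az; exact: half_lens_rigid.
  by rewrite -bz; exact: half_lens_rigid.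
(* A half-lens is open, so a point of the one contained in [S l] is interior to [S l]. *)
move=> q [qA qB]; exists q; left; split; first exact: subA.
apply: (@interiorS _ _ _ subB).
by rewrite /interior; apply: open_nbhs_nbhs; split => //; exact: open_half_lens.
Qed.
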